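(* Let $p$ be an odd prime and $n\ge4$ an integer with base-$p$ expansion $n=n_0+n_1p+\cdots+n_kp^k$, $n_j\in\{0,\ldots,p-1\}$, $n_k>0$. For a pseudo-composition $\gamma=(\gamma_1,\ldots,\gamma_\ell)$ of $n$ write $\gamma_i=\sum_{j=0}^k\gamma_{ij}p^j$ with digits $\gamma_{ij}\in\{0,\ldots,p-1\}$. For each pseudo-composition $\beta=(\beta_1,\ldots,\beta_\ell)$ of $n$ define $\beta'$ and $\nu_p(\beta')\in\mathbb{Z}_p$ by: - if $\beta_1=0$: $\beta':=\beta$ and $\nu_p(\beta'):=\tfrac12\prod_{j=0}^k2^{n_j}\binom{n_j}{\beta'_{1j},\ldots,\beta'_{\ell j}}$ (with $\tfrac12$ the inverse of $2$ modulo $p$); - if $\beta_1=1$: $\beta':=(0,1+\beta_2,\beta_3,\ldots,\beta_\ell)$ and $\nu_p(\beta')$ is defined by the same formula as in the case $\beta_1=0$ applied to $\beta'$; - if $\beta_1>1$: $\beta':=\beta$ and $\nu_p(\beta'):=\prod_{j=0}^k2^{n_j-\beta'_{1j}}\binom{n_j}{\beta'_{1j},\ldots,\beta'_{\ell j}}$. Let \[ P:=\bigl(\{b_0+b_1p+\cdots+b_kp^k: 0\le b_j\le n_j\}\cup\{1\}\bigr)\setminus\{n\}\subseteq\{0,1,\ldots,n-1\}, \] and for $T\subseteq P$ let \[ r^D(T):=\sum_{\substack{\beta\models_0 n,\ D(\beta)\subseteq T\\ \beta'_{1j}+\cdots+\beta'_{\ell' j}=n_j\ \forall j}}(-1)^{|T|-|D(\beta)|}\nu_p(\beta'),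 \] where $\ell'$ is the length of $\beta'$. Then $|P|=\prod_{j=0}^k(n_j+1)$ if $n_0=0$ and $|P|=\prod_{j=0}^k(n_j+1)-1$ if $n_0>0$, and for every $i\in\mathbb{Z}_p$, \[ c^D_{p,i}(n)=\begin{cases} 2^{\,n-|P|}\,|\{T\subseteq P: r^D(T)\equiv i\pmod p\}| & \text{if } i=0\text{ or } n_0=\cdots=n_{k-1}=p-1,\\ 2^{\,n-|P|-1}\,|\{T\subseteq P: r^D(T)\equiv i\text{ or } r^D(T)\equiv -i\pmod p\}| & \text{otherwise.}\end{cases} \]
   Context: A signed permutation of $[n]$ is a bijection $w$ of $\{\pm1,\ldots,\pm n\}$ with $w(-i)=-w(i)$; it is even if an even number of $w(1),\ldots,w(n)$ are negative; these form $\mathfrak{S}^D_n$. With the convention $w(0):=-w(2)$, $D(w)=\{i\in\{0,\ldots,n-1\}: w(i)>w(i+1)\}$. A pseudo-composition of $n$ ($\alpha\models_0 n$) is a sequence $(\alpha_1,\ldots,\alpha_\ell)$ of integers with $\alpha_1\ge0$, $\alpha_2,\ldots,\alpha_\ell>0$ and sum $n$, with $D(\alpha)=\{\alpha_1,\alpha_1+\alpha_2,\ldots,\alpha_1+\cdots+\alpha_{\ell-1}\}$. The type $D$ ribbon number is $r^D_\alpha=|\{w\in\mathfrak{S}^D_n: D(w)=D(\alpha)\}|$ and $c^D_{p,i}(n)=|\{\alpha\models_0 n: r^D_\alpha\equiv i\pmod p\}|$. Multinomial coefficients $\binom{m}{m_1,\ldots,m_k}$ equal $m!/(m_1!\cdots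 m_k!)$ if $\sum m_i=m$ and $0$ otherwise. *)

(* Defs.v *)
From HB Require Import structures.
From mathcomp Require Import all_boot all_order all_fingroup all_algebra.
Set Implicit Arguments. Unset Strict Implicit. Unset Printing Implicit Defensive.
Import Order.TTheory GRing.Theory Num.Theory.

(* ---------- Signed permutations of [n] ----------
   A signed permutation w is encoded as a pair (s, neg) with s : {perm 'I_n}
   and neg : {ffun 'I_n -> bool}: for 1 <= i <= n,
   w(i) = -(s(i-1)+1) if neg (i-1), and  s(i-1)+1 otherwise.
   This is a bijection with the maps w of {+-1..+-n} with w(-i) = -w(i). *)
Definition sperm (n : nat) := prod {perm 'I_n} {ffun 'I_n -> bool}.

Definition oneline n (w : sperm n) : seq int :=
  [seq (if w.2 o then - ((w.1 o).+1)%:Z else ((w.1 o).+1)%:Z)%R | o <- enum 'I_n].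

(* w(i) for 1 <= i <= n, with the type-D convention w(0) := -w(2). *)
Definition wval n (w : sperm n) (i : nat) : int :=
  if i == 0 then (- nth 0%R (oneline w) 1)%R else nth 0%R (oneline w) i.-1.

Definition sp_even n (w : sperm n) : bool := ~~ odd #|[set o : 'I_n | w.2 o]|.

Definition Dw n (w : sperm n) : {set 'I_n} :=
  [set i : 'I_n | (wval w i.+1 < wval w i)%R].

Definition is_pcomp (n : nat) (a : seq nat) : bool :=
  [&& a != [::], all (fun x => 0 < x) (behead a) & sumn a == n].

Definition psums (a : seq nat) : seq nat :=
  [seq sumn (take j a) | j <- iota 1 (size a).-1].

Definition Dc (n : nat) (a : seq nat) : {set 'I_n} :=
  [set i : 'I_n | val i \in psums a].

Definition ribD (n : nat) (a : seq nat) : nat :=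
  #|[set w : sperm n | sp_even w && (Dw w == Dc n a)]|.

(* c^D_{p,i}(n), where L is a duplicate-free list of exactly the
   pseudo-compositions of n, and i : 'F_p (= Z/pZ for p prime). *)
Definition cD (n p : nat) (L : seq (seq nat)) (i : 'F_p) : nat :=
  count (fun a => ((ribD n a)%:R == i)%R) L.

Definition digit (p j m : nat) : nat := (m %/ p ^ j) %% p.

Definition multinom (m : nat) (s : seq nat) : nat :=
  if sumn s == m then m`! %/ \prod_(x <- s) x`! else 0.

Definition bprime (b : seq nat) : seq nat :=
  match b with
  | 1 :: b2 :: r => 0 :: b2.+1 :: r
  | _ => b
  end.

Section Nu.
Variables (p k : nat) (nd : nat -> nat).
Local Open Scope ring_scope.

Definition digs (j : nat) (b : seq nat) : seq nat := [seq digit p j x | x <- b].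

Definition nu (b : seq nat) : 'F_p :=
  let b' := bprime b in
  if (head 0%N b <= 1)%N then
    (2 : 'F_p)^-1 * \prod_(j < k.+1) (2 ^+ nd j * (multinom (nd j) (digs j b'))%:R)
  else
    \prod_(j < k.+1) (2 ^+ (nd j - digit p j (head 0%N b'))%N
                       * (multinom (nd j) (digs j b'))%:R).

Definition Pset (n : nat) : {set 'I_n} :=
  [set x : 'I_n |
     ([exists b : {ffun 'I_k.+1 -> 'I_p},
         [forall j, (b j <= nd j)%N] && (val x == \sum_(j < k.+1) b j * p ^ j)%N]
      || (val x == 1%N)) && (val x != n)].

Definition rDT (n : nat) (L : seq (seq nat)) (T : {set 'I_n}) : 'F_p :=
  \sum_(b <- L | (Dc n b \subset T) &&
                 [forall j : 'I_k.+1, sumn (digs j (bprime b)) == nd j])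
     (-1) ^+ (#|T| - #|Dc n b|)%N * nu b.
End Nu.

(* Main.v *)
Require Import Defs.
From HB Require Import structures.
From mathcomp Require Import all_boot all_order all_fingroup all_algebra.
From mathcomp Require Import zify.
Import Order.TTheory GRing.Theory Num.Theory.
Set Implicit Arguments. Unset Strict Implicit. Unset Printing Implicit Defensive.

(** Let N(U) be the number of even signed permutations whose descent set is
contained in U. Descent sets are subsets of {0, ..., n-1}, in bijection with
pseudo-compositions, so Moebius inversion gives
r^D(S) = sum over U in S of (-1)^(|S|-|U|) N(U). If U = D(b) with b_1 = 0, then N(U) is
2^(n-1) times a multinomial coefficient; if b_1 > 1, the first block has absolute
values increasing with at most its first entry negative, that sign being forced by
parity, and the power of 2 becomes 2^(n-b_1); the case b_1 = 1 reduces to b_1 = 0 by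
the diagram automorphism exchanging 0 and 1. Lucas' theorem and x^p = x turn N(U)
into nu_p modulo p, which vanishes unless b' adds up to n without carries; then all
partial sums of b' are digitwise below n, so U lies in P. Hence modulo p
r^D(S) = (-1)^|S \ P| r^D(S /\ P), and the theorem follows because P has either empty
complement or as many even as odd subsets in its complement. *)

(** * Lucas' theorem *)

(** The coefficient form of (1 + X)^p = 1 + X^p modulo p: in the Vandermonde convolution, p divides
    'C(p, j) unless j is 0 or p. *)
Lemma bin_addn_prime_mod (p n m : nat) : prime p ->
  'C(n + p, m) = 'C(n, m) + (if p <= m then 'C(n, m - p) else 0) %[mod p].
Proof.
move=> p_pr; have p_gt0 := prime_gt0 p_pr.
rewrite addnC -binomial.Vandermonde.
have binp_mod j : 'C(p, j) * 'C(n, m - j) =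
    (j == 0) * 'C(n, m) + (j == p) * 'C(n, m - p) %[mod p].
  case: (eqVneq j 0) => [->|j_neq0]; first by rewrite bin0 subn0 (ltn_eqF p_gt0) addn0.
  case: (eqVneq j p) => [->|j_neqp]; first by rewrite binn.
  rewrite mul0n add0n; have [j_ltp|p_le_j] := ltnP j p.
    have /eqP p_dvd : p %| 'C(p, j) by rewrite prime_dvd_bin // lt0n j_neq0.
    by rewrite -modnMml p_dvd.
  by rewrite bin_small ?mul0n // ltn_neqAle eq_sym j_neqp.
have -> : 'C(n, m) + (if p <= m then 'C(n, m - p) else 0) =
   \sum_(j < m.+1) ((j == 0 :> nat) * 'C(n, m) + (j == p :> nat) * 'C(n, m - p)).
  rewrite big_split /= big_ord_recl /= big1 ?addn0 ?mul1n //; congr (_ + _).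
  case: leqP => [p_le_m|m_ltp].
    rewrite (bigD1 (inord p)) //= inordK // eqxx mul1n big1 ?addn0 // => j.
    by rewrite -val_eqE /= inordK // => /negbTE->.
  rewrite big1 // => j _; case: eqP => // jp.
  by have := ltn_ord j; rewrite jp ltnS leqNgt m_ltp.
by rewrite -modn_summ -[in RHS]modn_summ; congr (_ %% _); apply: eq_bigr.
Qed.

(** Raising n by 1 adds p to the upper entry, so the previous congruence becomes Pascal's rule for
    'C(n, m). *)
Lemma lucas_step (p n m n0 m0 : nat) : prime p -> n0 < p -> m0 < p ->
  'C(n0 + p * n, m0 + p * m) = 'C(n0, m0) * 'C(n, m) %[mod p].
Proof.
move=> p_pr n0p m0p; have p_gt0 := prime_gt0 p_pr.
elim: n m => [|n IHn] m.
  rewrite muln0 addn0; case: m => [|m]; first by rewrite muln0 addn0 bin0 muln1.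
  rewrite bin0n muln0 bin_small // (leq_trans n0p) // mulnS addnCA leq_addr //.
rewrite mulnS addnCA addnC bin_addn_prime_mod //.
case: m => [|m].
  rewrite muln0 addn0 leqNgt m0p /= addn0 bin0 muln1.
  by have := IHn 0; rewrite muln0 addn0 bin0 muln1.
rewrite {2 3}mulnS addnCA leq_addr addKn binS mulnDr.
by rewrite -modnDm IHn IHn modnDm.
Qed.

Lemma digit0 (p m : nat) : digit p 0 m = m %% p.
Proof. by rewrite /digit expn0 divn1. Qed.

Lemma digitS (p j m : nat) : digit p j.+1 m = digit p j (m %/ p).
Proof. by rewrite /digit expnS divnMA. Qed.

Lemma digit_lt (p j m : nat) : 0 < p -> digit p j m < p.
Proof. exact: ltn_pmod. Qed.

Lemma lucas (p K n m : nat) : prime p -> n < p ^ K -> m < p ^ K ->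
  'C(n, m) = \prod_(j < K) 'C(digit p j n, digit p j m) %[mod p].
Proof.
move=> p_pr; have p_gt0 := prime_gt0 p_pr.
elim: K n m => [|K IHK] n m.
  by rewrite expn0 !ltnS !leqn0 => /eqP-> /eqP->; rewrite bin0 big_ord0.
rewrite expnSr => n_lt m_lt; rewrite big_ord_recl !digit0.
rewrite {1}(divn_eq n p) {1}(divn_eq m p) ![_ %/ p * p + _]addnC ![_ %/ p * p]mulnC.
rewrite lucas_step ?ltn_mod // -modnMmr IHK ?ltn_divLR // modnMmr.
by under eq_bigr do rewrite -!digitS.
Qed.

Lemma digit_sum (p K : nat) (b : nat -> nat) (j : nat) :
  (forall i, i < K -> b i < p) -> j < K -> digit p j (\sum_(i < K) b i * p ^ i) = b j.
Proof.
elim: K j b => // K IHK j b b_lt j_lt; rewrite big_ord_recl expn0 muln1.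
have p_gt0 : 0 < p := leq_ltn_trans (leq0n _) (b_lt 0 isT).
have -> : \sum_(i < K) b (bump 0 i) * p ^ bump 0 i = (\sum_(i < K) b i.+1 * p ^ i) * p.
  by rewrite big_distrl; apply: eq_bigr => i _ /=; rewrite expnSr mulnA.
case: j j_lt => [|j] j_lt; first by rewrite digit0 addnC modnMDl modn_small ?b_lt.
rewrite digitS addnC divnMDl // divn_small ?b_lt // addn0.
by apply: (IHK j (fun i => b i.+1)) => // i i_lt; exact: b_lt.
Qed.

Lemma digit_expansion (p K m : nat) : 0 < p -> m < p ^ K ->
  m = \sum_(j < K) digit p j m * p ^ j.
Proof.
move=> p_gt0; elim: K m => [|K IHK] m.
  by rewrite expn0 big_ord0; case: m.
rewrite expnSr => m_lt; rewrite big_ord_recl digit0 expn0 muln1.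
rewrite {1}(divn_eq m p) addnC; congr (_ + _).
rewrite {1}[m %/ p]IHK ?ltn_divLR // big_distrl; apply: eq_bigr => i _ /=.
by rewrite -digitS expnSr mulnA.
Qed.

Lemma sum_digits_lt (p K : nat) (b : nat -> nat) :
  (forall i, b i < p) -> \sum_(i < K) b i * p ^ i < p ^ K.
Proof.
move=> b_lt; have p_gt0 : 0 < p := leq_ltn_trans (leq0n _) (b_lt 0).
elim: K => [|K IHK]; first by rewrite big_ord0 expn0.
rewrite big_ord_recr /= -(addn1 (_ + _)) addnAC addn1 expnS.
have := leq_add IHK (leqnn (b K * p ^ K)); rewrite -mulSn => /leq_trans; apply.
by rewrite leq_mul2r b_lt orbT.
Qed.

(** * Multinomial coefficients modulo a prime *)

Lemma prod_fact_dvd (s : seq nat) : \prod_(x <- s) x`! %| (sumn s)`!.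
Proof.
elim: s => [|x s IHs]; first by rewrite big_nil.
rewrite big_cons /= -(bin_fact (leq_addr (sumn s) x)) addKn.
by rewrite dvdn_mull // dvdn_mul.
Qed.

Lemma prod_fact_gt0 (s : seq nat) : 0 < \prod_(x <- s) x`!.
Proof. by rewrite big_seq; apply: prodn_cond_gt0 => x _; rewrite fact_gt0. Qed.

Lemma multinom_fact (s : seq nat) :
  multinom (sumn s) s * \prod_(x <- s) x`! = (sumn s)`!.
Proof. by rewrite /multinom eqxx divnK ?prod_fact_dvd. Qed.

(** Peeling off one part reduces multinomial statements to binomial ones; when x exceeds m both
    sides are 0, so the sum convention is respected. *)
Lemma multinom_cons (m x : nat) (s : seq nat) :
  multinom m (x :: s) = 'C(m, x) * multinom (m - x) s.
Proof.
have [x_le_m|m_lt_x] := leqP x m; last first.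
  rewrite bin_small // mul0n /multinom /= ifF //; apply/eqP; lia.
rewrite /multinom /= big_cons.
have -> : (x + sumn s == m) = (sumn s == m - x) by apply/eqP/eqP; lia.
case: eqP => [sE|]; last by rewrite muln0.
rewrite -(bin_fact x_le_m) mulnCA divnMl ?fact_gt0 // muln_divA //.
by rewrite -sE prod_fact_dvd.
Qed.

(** Digitwise domination means that the subtraction involves no borrow. *)
Lemma digit_sub (p K n m j : nat) : 0 < p -> n < p ^ K -> m < p ^ K ->
  (forall i, i < K -> digit p i m <= digit p i n) -> j < K ->
  digit p j (n - m) = digit p j n - digit p j m.
Proof.
move=> p_gt0 n_lt m_lt le_dig jK.
have -> : n - m = \sum_(i < K) (digit p i n - digit p i m) * p ^ i.
  rewrite {1}(digit_expansion p_gt0 n_lt) {1}(digit_expansion p_gt0 m_lt).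
  apply/eqP; rewrite eq_sym -(eqn_add2r (\sum_(i < K) digit p i m * p ^ i)).
  rewrite subnK; last by apply: leq_sum => i _; rewrite leq_mul2r le_dig ?orbT.
  rewrite -big_split; apply/eqP/eq_bigr => i _ /=.
  by rewrite -mulnDl subnK ?le_dig.
apply: (@digit_sum p K (fun i => digit p i n - digit p i m)) => // i _.
by rewrite (leq_ltn_trans (leq_subr _ _)) ?digit_lt.
Qed.

(** Induction on the parts. If the first part x is digitwise below n, then n - x has the digit
    differences as digits and the induction applies; otherwise both sides vanish modulo p. *)
Lemma lucas_multinom (p K n : nat) (s : seq nat) : prime p -> n < p ^ K ->
  sumn s = n ->
  multinom n s = \prod_(j < K) multinom (digit p j n) (digs p j s) %[mod p].
Proof.
move=> p_pr; have p_gt0 := prime_gt0 p_pr.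
elim: s n => [|x s IHs] n n_lt /= sE.
  rewrite -sE big1 => [|j _]; first by rewrite /multinom big_nil divn1.
  by rewrite /multinom /digit /= div0n mod0n big_nil divn1.
have x_lt : x < p ^ K by rewrite (leq_ltn_trans _ n_lt) // -sE leq_addr.
rewrite multinom_cons.
have [le_dig|] := boolP [forall j : 'I_K, digit p j x <= digit p j n].
  rewrite -modnMmr IHs; last 2 first.
  - exact: leq_ltn_trans (leq_subr _ _) n_lt.
  - by rewrite -sE addKn.
  rewrite modnMmr -modnMml (lucas p_pr n_lt x_lt) modnMml -big_split /=.
  congr (_ %% _); apply: eq_bigr => j _.
  rewrite multinom_cons (@digit_sub p K) // => i iK.
  exact: (forallP le_dig (Ordinal iK)).
(* Digit j of x exceeds that of n, so both products contain the factor 0 at j. *)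
rewrite negb_forall => /existsP[j]; rewrite -ltnNge => j_lt.
rewrite -modnMml (lucas p_pr n_lt x_lt) modnMml.
by rewrite [in RHS](bigD1 j) //= multinom_cons (bigD1 j) //= !(bin_small j_lt).
Qed.

(** * Block-preserving permutations *)

Lemma card_bij_on (T1 T2 : finType) (A : {pred T1}) (B : {pred T2})
  (f : T1 -> T2) (g : T2 -> T1) :
  {in A, forall x, f x \in B} -> {in B, forall y, g y \in A} ->
  {in A, cancel f g} -> {in B, cancel g f} -> #|A| = #|B|.
Proof.
move=> fAB gBA fK gK; apply/eqP; rewrite eqn_leq; apply/andP; split.
  rewrite -(card_in_imset (can_in_inj fK)); apply/subset_leq_card/subsetP => y.
  by case/imsetP=> x xA ->; apply: fAB.
rewrite -(card_in_imset (can_in_inj gK)); apply/subset_leq_card/subsetP => x.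
by case/imsetP=> y yB ->; apply: gBA.
Qed.

(** Toggling a fixed element x of A is an involution that exchanges even and odd subsets. *)
Lemma card_subsets_parity (T : finType) (A : {set T}) (b : bool) : A != set0 ->
  #|[set U : {set T} | (U \subset A) && (odd #|U| == b)]| = 2 ^ (#|A| - 1).
Proof.
case/set0Pn=> x xA.
pose S (c : bool) := [set U : {set T} | (U \subset A) && (odd #|U| == c)].
pose tog (U : {set T}) := if x \in U then U :\ x else x |: U.
have togK : involutive tog.
  move=> U; rewrite /tog; case: (boolP (x \in U)) => xU; first by rewrite setD11 setD1K.
  by rewrite setU11 setU1K.
have togS c : {in S c, forall U, tog U \in S (~~ c)}.
  move=> U; rewrite !inE /tog => /andP[UA /eqP<-]; case: ifP => xU.
    rewrite (subset_trans (subsetDl _ _) UA) /=.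
    by rewrite [#|U|](cardsD1 x) xU /= negbK.
  by rewrite subUset sub1set xA UA /= cardsU1 xU.
have cardS c : #|S c| = #|S (~~ c)|.
  apply: (@card_bij_on _ _ _ _ tog tog) => [U|U|U _|U _]; rewrite ?togK //.
    exact: togS.
  by move/togS; rewrite negbK.
have cardA : #|powerset A| = #|S true| + #|S false|.
  rewrite -cardsUI -[LHS]addn0 -(cards0 {set T}); congr (_ + _); congr #|pred_of_set _|.
    by apply/setP=> U; rewrite !inE -andb_orr; case: odd; rewrite andbT.
  by apply/setP=> U; rewrite !inE; case: odd; rewrite !(andbF, andFb).
have := cardA; rewrite card_powerset -[#|S true|]/(#|S (~~ false)|) -cardS.
have -> : #|S false| = #|S b| by case: b => //; rewrite cardS.
have: 0 < #|A| by rewrite card_gt0; apply/set0Pn; exists x.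
by case: #|A| => // m _; rewrite expnS subn1 /= -/(S b); lia.
Qed.

Lemma nth_map_enum_ord (T : Type) (n : nat) (x0 : T) (f : 'I_n -> T) (i : 'I_n) :
  nth x0 [seq f j | j <- enum 'I_n] i = f i.
Proof. by rewrite (nth_map i) ?size_enum_ord // nth_ord_enum. Qed.

Section Blocks.
Variables (n : nat) (c : 'I_n -> nat).

Definition block_perms : {set {perm 'I_n}} :=
  [set y : {perm 'I_n} | [forall i, c (y i) == c i]].

(** A block-preserving permutation amounts to an independent permutation of each fibre of [c]: [F]
    restricts to the fibres and [G] glues. *)
Lemma card_block_perms (m : nat) : (forall i, c i < m) ->
  #|block_perms| = \prod_(k < m) (#|[set i | c i == k]|)`!.
Proof.
move=> c_lt; pose fib (k : 'I_m) := [set i | c i == k].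
pose C i := Ordinal (c_lt i).
have fibE i k : (i \in fib k) = (C i == k) by rewrite inE -val_eqE.
transitivity #|family (fun k : 'I_m => perm_on (fib k))|; last first.
  rewrite card_family -[RHS]big_enum /= /image_mem.
  elim: (enum _) => [|k r IHr]; first by rewrite big_nil.
  by rewrite big_cons /= -IHr card_perm.
pose F (y : {perm 'I_n}) := [ffun k : 'I_m => restr_perm (fib k) y].
pose g0 (g : {ffun 'I_m -> {perm 'I_n}}) i := g (C i) i.
(* The default 1 is never reached on the family, where the glued map is injective. *)
pose G g := insubd (1%g : {perm 'I_n}) (finfun (g0 g)).
have g0P g : g \in family (fun k : 'I_m => perm_on (fib k)) ->
    (forall i, C (g0 g i) = C i) /\ injective (g0 g).
  move=> /familyP gP.
  have CE i : C (g0 g i) = C i.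
    apply/eqP; rewrite -fibE perm_closed ?fibE //; exact: (gP (C i)).
  split=> // i j eq_g; have := CE i; rewrite eq_g CE => Cij.
  by move: eq_g; rewrite /g0 Cij => /perm_inj.
have GE g i : g \in family (fun k : 'I_m => perm_on (fib k)) -> G g i = g0 g i.
  move=> /g0P[_ g_inj]; rewrite /G -pvalE -[pval _]/(val _) val_insubd.
  rewrite ifT ?ffunE //; apply/injectiveP => a b; rewrite !ffunE; exact: g_inj.
have FE y i k : y \in block_perms -> F y k i = if C i == k then y i else i.
  rewrite inE => /forallP yP; rewrite ffunE -fibE; case: ifPn => ik; last first.
    by apply: (out_perm (restr_perm_on _ _)).
  rewrite restr_permE //; apply/astabsP => j /=.
  by rewrite apermE !inE (eqP (yP j)).
apply: (@card_bij_on _ _ _ _ F G) => [y yB|g gB|y yB|g gB].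
- apply/familyP => k; rewrite ffunE; exact: restr_perm_on.
- rewrite inE; apply/forallP => i; rewrite GE //.
  by have [CE _] := g0P _ gB; have /(congr1 val)/= -> := CE i.
- apply/permP => i; rewrite GE ?[g0 _ _]FE ?eqxx //.
  by apply/familyP => k; rewrite ffunE; exact: restr_perm_on.
- have GB : G g \in block_perms.
    rewrite inE; apply/forallP => i; rewrite GE //.
    by have [CE _] := g0P _ gB; have /(congr1 val)/= -> := CE i.
  apply/ffunP => k; apply/permP => i; rewrite FE // GE //.
  case: eqP => [<-//|/eqP ik]; apply/esym/(out_perm (familyP gB k)).
  by rewrite fibE.
Qed.

(** Adjacent positions suffice: for monotone [c] the blocks are intervals, so this means increasing
    on each block. *)
Definition block_increasing (v : 'I_n -> int) : bool :=
  [forall i : 'I_n, forall j : 'I_n, (j == i.+1 :> nat) && (c i == c j) ==> (v i < v j)%R].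

(* Such an arrangement is the list of all positions sorted for the
   lexicographic order on (block, value); monotonicity of c makes sorting
   preserve blocks. *)
Lemma unique_block_sort (v : 'I_n -> int) : injective v ->
  (forall i j : 'I_n, i <= j -> c i <= c j) ->
  #|[set y in block_perms | block_increasing (v \o y)]| = 1.
Proof.
move=> v_inj c_homo.
pose r : rel 'I_n := fun i j => (c i < c j) || ((c i == c j) && (v i <= v j)%R).
have r_total : total r.
  by move=> i j; rewrite /r; case: (ltngtP (c i) (c j)) => //= _; exact: le_total.
have r_trans : transitive r.
  move=> j i k; rewrite /r.
  case: (ltngtP (c i) (c j)) => //= ij; case: (ltngtP (c j) (c k)) => //= jk.
  - by rewrite (ltn_trans ij jk).
  - by rewrite -jk ij.
  - by rewrite ij jk.
  - by rewrite ij jk ltnn eqxx /=; exact: le_trans.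
have r_anti : antisymmetric r.
  move=> i j; rewrite /r; case: (ltngtP (c i) (c j)) => //= _ /le_anti; exact: v_inj.
have enum_le : sorted (fun i j : 'I_n => i <= j) (enum 'I_n).
  by rewrite -(sorted_map (f := @nat_of_ord n) (e' := leq)) val_enum_ord iota_sorted.
have cP (y : {perm 'I_n}) :
    (y \in [set y in block_perms | block_increasing (v \o y)]) =
    sorted r [seq y i | i <- enum 'I_n].
  have pE : perm_eq [seq y i | i <- enum 'I_n] (enum 'I_n).
    apply: uniq_perm; rewrite ?enum_uniq ?(map_inj_uniq perm_inj) ?enum_uniq // => i.
    rewrite mem_enum; apply/mapP; exists (y^-1%g i); rewrite ?mem_enum //.
    by rewrite permKV.
  have nth_y i0 (i : 'I_n) : nth i0 [seq y i | i <- enum 'I_n] i = y i.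
    exact: nth_map_enum_ord.
  rewrite !inE; apply/andP/idP => [[/forallP yB /forallP y_inc]|sorted_y].
    case: (posnP n) => [n0|n_gt0].
      have /nilP-> // : nilp (enum 'I_n) by rewrite /nilp size_enum_ord n0.
    pose i0 := Ordinal n_gt0.
    apply/(sortedP i0) => i; rewrite size_map size_enum_ord => i1_lt.
    have i_lt := ltnW i1_lt.
    have := nth_y i0 (Ordinal i_lt); have := nth_y i0 (Ordinal i1_lt) => /= -> ->.
    rewrite /r (eqP (yB _)) (eqP (yB (Ordinal i1_lt))).
    have := c_homo (Ordinal i_lt) (Ordinal i1_lt) (leqnSn i).
    rewrite leq_eqVlt => /orP[cE|->//]; rewrite cE orbC.
    have /forallP/(_ (Ordinal i1_lt)) := y_inc (Ordinal i_lt).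
    by rewrite /= eqxx cE /= => /ltW ->.
  (* Sortedness forces block preservation: the block numbers read along y and along the identity are
     sorted rearrangements of one another, hence equal. *)
  have yB i : c (y i) = c i.
    have cE : [seq c (y i) | i <- enum 'I_n] = [seq c i | i <- enum 'I_n].
      apply: (sorted_eq leq_trans anti_leq).
      - rewrite (map_comp c y) sorted_map.
        apply: sub_sorted sorted_y => a b; rewrite /r /=.
        by case/orP=> [/ltnW//|/andP[/eqP-> _]].
      - by rewrite sorted_map; apply: sub_sorted enum_le => a b; exact: c_homo.
      - by rewrite (map_comp c y); apply: perm_map.
    by rewrite -(nth_map_enum_ord 0 (fun j => c (y j))) cE nth_map_enum_ord.
  split; first by apply/forallP => i; rewrite yB.
  apply/forallP => i; apply/forallP => j; apply/implyP => /andP[/eqP ji /eqP cij] /=.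
  have := (sortedP i sorted_y) i; rewrite size_map size_enum_ord -ji ltn_ord !nth_y.
  move=> /(_ isT); rewrite /r !yB cij ltnn eqxx /= lt_neqAle => ->.
  rewrite andbT; apply/eqP => /v_inj/perm_inj/(congr1 val)/= ij; move: ji; rewrite ij; lia.
pose s := sort r (enum 'I_n).
have size_s : size s == n by rewrite size_sort size_enum_ord.
have s_uniq : uniq s by rewrite sort_uniq enum_uniq.
have f_inj : injective (tnth (Tuple size_s)).
  by apply/tuple_uniqP.
have yE : [seq perm f_inj i | i <- enum 'I_n] = s.
  rewrite -[RHS]/(tval (Tuple size_s)) -[RHS]map_tnth_enum.
  by apply: eq_map => i; rewrite permE.
rewrite -[RHS](cards1 (perm f_inj)); apply: eq_card => y; rewrite cP inE.
apply/idP/eqP => [y_sorted|->]; last by rewrite yE sort_sorted.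
apply/permP => i.
have sE : [seq y i | i <- enum 'I_n] = [seq perm f_inj i | i <- enum 'I_n].
  apply: (sorted_eq r_trans r_anti) => //; first by rewrite yE sort_sorted.
  apply: uniq_perm; rewrite ?(map_inj_uniq perm_inj) ?enum_uniq // => j.
  apply/mapP/mapP => -[k _ ->].
    by exists ((perm f_inj)^-1%g (y k)); rewrite ?mem_enum ?permKV.
  by exists (y^-1%g (perm f_inj k)); rewrite ?mem_enum ?permKV.
by rewrite -(nth_map_enum_ord i y) sE nth_map_enum_ord.
Qed.
End Blocks.

(** * Pseudo-compositions and subsets *)

Lemma size_psums (a : seq nat) : size (psums a) = (size a).-1.
Proof. by rewrite size_map size_iota. Qed.

Lemma nth_psums (a : seq nat) (j : nat) : j < (size a).-1 ->
  nth 0 (psums a) j = sumn (take j.+1 a).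
Proof. by move=> j_lt; rewrite (nth_map 0) ?size_iota // nth_iota. Qed.

Lemma sumn_takeS (a : seq nat) (j : nat) :
  sumn (take j.+1 a) = sumn (take j a) + nth 0 a j.
Proof.
have [j_lt|j_ge] := ltnP j (size a); first by rewrite (take_nth 0) // sumn_rcons.
by rewrite !take_oversize ?nth_default ?addn0 // ltnW.
Qed.

Lemma leq_sumn_take (a : seq nat) (i j : nat) : i <= j -> sumn (take i a) <= sumn (take j a).
Proof.
by move/subnK<-; elim: (j - i) => // d IHd; rewrite addSn sumn_takeS (leq_trans IHd) ?leq_addr.
Qed.

Lemma leq_sumn_take_sumn (a : seq nat) (j : nat) : sumn (take j a) <= sumn a.
Proof.
rewrite -[X in _ <= sumn X](take_size a); have [|/ltnW] := leqP j (size a).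
  exact: leq_sumn_take.
by move=> j_ge; rewrite take_size take_oversize.
Qed.

Section Pcomp.
Variables (n : nat) (a : seq nat).
Hypothesis a_pcomp : is_pcomp n a.

Lemma pcomp_size_gt0 : 0 < size a.
Proof. by case/and3P: a_pcomp; case: (a). Qed.

Lemma pcomp_sumn : sumn a = n.
Proof. by case/and3P: a_pcomp => _ _ /eqP. Qed.

Lemma pcomp_nth_gt0 (j : nat) : 0 < j < size a -> 0 < nth 0 a j.
Proof.
case/and3P: a_pcomp => _ /allP a_pos _; case: j => // j; rewrite -nth_behead /= => j_lt.
by apply/a_pos/mem_nth; rewrite size_behead; case: (size a) j_lt.
Qed.

Lemma sumn_take_ltS (j : nat) : 0 < j < size a -> sumn (take j a) < sumn (take j.+1 a).
Proof. by move=> /pcomp_nth_gt0; rewrite sumn_takeS; lia. Qed.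

Lemma psums_sorted : sorted ltn (psums a).
Proof.
apply/(sortedP 0) => j; rewrite size_psums => j_lt /=.
by rewrite !nth_psums ?sumn_take_ltS //; lia.
Qed.

Lemma psums_lt (d : nat) : d \in psums a -> d < n.
Proof.
move=> /(nthP 0)[j]; rewrite size_psums => j_lt <-; rewrite nth_psums //.
apply: (@leq_trans (sumn (take j.+2 a))); first by rewrite sumn_take_ltS //; lia.
by rewrite -pcomp_sumn leq_sumn_take_sumn.
Qed.

(** The parts are the successive gaps of the partial sums framed by 0 and n, so a pseudo-composition
    is determined by its descent set. *)
Lemma pcomp_psums : a = pairmap (fun x y => y - x) 0 (rcons (psums a) n).
Proof.
have size_gt0 := pcomp_size_gt0.
have size_rc : size (rcons (psums a) n) = size a.
  by rewrite size_rcons size_psums prednK.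
have nth_rc j : j < size a -> nth 0 (rcons (psums a) n) j = sumn (take j.+1 a).
  move=> j_lt; rewrite nth_rcons size_psums.
  case: ltngtP => [|size_lt|->]; first exact: nth_psums.
    by move: j_lt size_lt size_gt0; case: (size a) => //= m; lia.
  by rewrite prednK // take_size pcomp_sumn.
apply: (@eq_from_nth _ 0) => [|j j_lt]; first by rewrite size_pairmap size_rc.
rewrite (nth_pairmap 0) ?size_rc // nth_rc //.
have -> : nth 0 (0 :: rcons (psums a) n) j = sumn (take j a).
  by case: j j_lt => [|j] j_lt; rewrite ?take0 //= nth_rc // ltnW.
by rewrite sumn_takeS addKn.
Qed.

(** The block, numbered from 0, that contains the zero-based position i: each partial sum at most i
    ends an earlier block. A first part 0 yields an empty block 0. *)
Definition block_of (i : nat) : nat := count (fun d => d <= i) (psums a).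

Lemma block_of_homo (i j : nat) : i <= j -> block_of i <= block_of j.
Proof. by move=> ij; apply: sub_count => d /= di; apply: leq_trans ij. Qed.

Lemma block_ofS (i : nat) : block_of i.+1 = block_of i + (i.+1 \in psums a).
Proof.
have psums_uniq : uniq (psums a).
  exact: (sorted_uniq ltn_trans ltnn psums_sorted).
rewrite -(count_uniq_mem _ psums_uniq) /block_of -count_predUI.
rewrite -[LHS]addn0; congr (_ + _).
  by apply: eq_count => d /=; rewrite leq_eqVlt orbC ltnS.
by apply/esym/eqP; rewrite -leqn0 leqNgt -has_count; apply/hasPn => d _ /=; lia.
Qed.

Lemma block_of_lt (i : nat) : block_of i < size a.
Proof.
by rewrite -(prednK pcomp_size_gt0) ltnS -size_psums count_size.
Qed.

(** In an increasing list the entries at most i form a prefix. *)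
Lemma sorted_count_gt (s : seq nat) (i k : nat) : sorted ltn s ->
  (k < count (fun d => d <= i) s) = (k < size s) && (nth 0 s k <= i).
Proof.
elim: s k => [|x s IHs] k //= x_s; have s_sorted := path_sorted x_s.
have x_lt : all (ltn x) s by apply: order_path_min x_s; exact: ltn_trans.
have [x_le|i_lt] := leqP x i; first by case: k => [|k] //=; rewrite add1n !ltnS IHs.
have -> : count (fun d => d <= i) s = 0.
  apply/eqP; rewrite -leqn0 leqNgt -has_count; apply/hasPn => d /(allP x_lt) /=; lia.
case: k => [|k] /=; first by lia.
rewrite ltnS; case: (ltnP k (size s)) => //= k_lt.
by have /= := allP x_lt _ (mem_nth 0 k_lt); lia.
Qed.

Lemma block_of_le (i k : nat) : i < n -> k < size a ->
  (block_of i <= k) = (i < sumn (take k.+1 a)).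
Proof.
move=> i_lt k_lt; rewrite leqNgt sorted_count_gt ?psums_sorted // size_psums.
case: (ltnP k (size a).-1) => k_lt1 /=; first by rewrite nth_psums // -ltnNge.
by rewrite take_oversize ?pcomp_sumn ?i_lt //; lia.
Qed.

Lemma card_ord_lt (m : nat) : m <= n -> #|[set i : 'I_n | i < m]| = m.
Proof.
move=> m_le; have widen_inj : injective (widen_ord m_le).
  by move=> i j /(congr1 val)/= /val_inj.
rewrite -[RHS]card_ord -(card_imset _ widen_inj).
apply: eq_card => i; rewrite inE; apply/idP/imsetP => [i_lt|[j _ ->]] /=.
  by exists (Ordinal i_lt) => //; apply: val_inj.
exact: ltn_ord.
Qed.

Lemma card_block (k : nat) : k < size a ->
  #|[set i : 'I_n | block_of i == k]| = nth 0 a k.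
Proof.
move=> k_lt; have take_le j : sumn (take j a) <= n.
  by rewrite -pcomp_sumn leq_sumn_take_sumn.
have -> : [set i : 'I_n | block_of i == k] =
    [set i : 'I_n | i < sumn (take k.+1 a)] :\: [set i : 'I_n | i < sumn (take k a)].
  apply/setP => i; rewrite !inE -block_of_le // eqn_leq andbC; congr (_ && _).
  case: k k_lt => [|k] k_lt; first by rewrite take0.
  by rewrite -block_of_le // -?ltnNge // ltnW.
rewrite cardsD (setIidPr _); last first.
  by apply/subsetP => i; rewrite !inE => /leq_trans; apply; rewrite leq_sumn_take.
by rewrite !card_ord_lt // sumn_takeS addKn.
Qed.

Lemma card_block_perms_pcomp :
  #|block_perms (fun i : 'I_n => block_of i)| = \prod_(x <- a) x`!.
Proof.
rewrite (card_block_perms (m := size a)) => [|i]; last exact: block_of_lt.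
by rewrite (big_nth 0) big_mkord; apply: eq_bigr => k _; rewrite card_block.
Qed.

End Pcomp.

(** The inverse of [Dc]. The first gap is 0 exactly when 0 lies in S, which is what the zero first
    part of a pseudo-composition records. *)
Definition pcomp_of_set n (S : {set 'I_n}) : seq nat :=
  pairmap (fun x y => y - x) 0 (rcons [seq val i | i <- enum S] n).

Lemma sorted_enum_val n (S : {set 'I_n}) : sorted ltn [seq val i | i <- enum S].
Proof.
apply: (subseq_sorted ltn_trans _ (iota_ltn_sorted 0 n)).
rewrite -val_enum_ord; apply: map_subseq.
by rewrite enumT; exact: filter_subseq.
Qed.

Lemma psums_Dc n a : is_pcomp n a -> psums a = [seq val i | i <- enum (Dc n a)].
Proof.
move=> a_pcomp; apply: (irr_sorted_eq ltn_trans ltnn).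
- exact: psums_sorted a_pcomp.
- exact: sorted_enum_val.
move=> d; apply/idP/mapP => [d_in|[i]].
  by exists (Ordinal (psums_lt a_pcomp d_in)); rewrite ?mem_enum ?inE.
by rewrite mem_enum inE => ? ->.
Qed.

Lemma DcK n : {in is_pcomp n, cancel (Dc n) (@pcomp_of_set n)}.
Proof. by move=> a a_pcomp; rewrite /pcomp_of_set -psums_Dc // -pcomp_psums. Qed.

(** Telescoping; monotonicity keeps the truncated subtractions exact. *)
Lemma sumn_take_pairmap (x0 : nat) (q : seq nat) (j : nat) :
  path leq x0 q -> j <= size q ->
  x0 + sumn (take j (pairmap (fun x y => y - x) x0 q)) = nth 0 (x0 :: q) j.
Proof.
elim: q x0 j => [|x q IHq] x0 [|j] //=; rewrite ?addn0 // ltnS => /andP[x0x qP] j_le.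
by rewrite addnA subnKC // IHq.
Qed.

Lemma pairmap_subn_gt0 (x : nat) (q : seq nat) :
  path ltn x q -> all (fun d => 0 < d) (pairmap (fun x y => y - x) x q).
Proof. by elim: q x => //= y q IHq x /andP[xy /IHq->]; rewrite subn_gt0 xy. Qed.

Section OfSet.
Variables (n : nat) (S : {set 'I_n}).
Let q := [seq val i | i <- enum S].

Lemma sorted_rcons_enum_val : sorted ltn (rcons q n).
Proof.
have := sorted_enum_val S; rewrite -/q; have : all (fun d => d < n) q.
  by apply/allP => d /mapP[i _ ->] /=.
case: q => //= x r /andP[x_lt r_lt] r_path; rewrite rcons_path r_path /=.
by have := mem_last x r; rewrite inE => /predU1P[->|/(allP r_lt)].
Qed.

Lemma path_rcons_enum_val : path leq 0 (rcons q n).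
Proof.
rewrite path_min_sorted; last by apply/allP.
by apply: sub_sorted sorted_rcons_enum_val => x y; exact: ltnW.
Qed.

Lemma size_pcomp_of_set : size (pcomp_of_set S) = (size q).+1.
Proof. by rewrite size_pairmap size_rcons. Qed.

Lemma pcomp_of_set_pcomp : is_pcomp n (pcomp_of_set S).
Proof.
apply/and3P; split; first by rewrite -size_eq0 size_pcomp_of_set.
  rewrite /pcomp_of_set -/q; have := sorted_rcons_enum_val.
  by case: (rcons q n) => //= x r /pairmap_subn_gt0.
apply/eqP; rewrite -[pcomp_of_set S]take_size -[LHS]add0n.
rewrite sumn_take_pairmap ?path_rcons_enum_val ?size_pcomp_of_set ?size_rcons //=.
by rewrite nth_rcons ltnn eqxx.
Qed.

Lemma psums_pcomp_of_set : psums (pcomp_of_set S) = q.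
Proof.
apply: (@eq_from_nth _ 0); rewrite size_psums size_pcomp_of_set // => j j_lt.
rewrite nth_psums ?size_pcomp_of_set // -[LHS]add0n.
rewrite sumn_take_pairmap ?path_rcons_enum_val //; last by rewrite size_rcons ltnS ltnW.
by rewrite /= nth_rcons j_lt.
Qed.

Lemma pcomp_of_setK : Dc n (pcomp_of_set S) = S.
Proof.
apply/setP => i; rewrite inE psums_pcomp_of_set.
by rewrite (mem_map val_inj) mem_enum.
Qed.
End OfSet.

(** * Signed permutations with prescribed descents *)

Section SignedPerm.
Variable n : nat.
Implicit Types (w : sperm n) (i : 'I_n).

Definition sval w i : int :=
  (if w.2 i then - ((w.1 i).+1)%:Z else ((w.1 i).+1)%:Z)%R.

Lemma wvalS w i : wval w i.+1 = sval w i.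
Proof. exact: nth_map_enum_ord. Qed.

Lemma wval0 w i : val i = 1 -> wval w 0 = (- sval w i)%R.
Proof. by move=> i1; rewrite -wvalS /= i1. Qed.

Lemma sval_inj w : injective (sval w).
Proof.
by move=> i j; rewrite /sval => eq_s; apply/(@perm_inj _ w.1)/val_inj => /=;
  move: eq_s; case: (w.2 i); case: (w.2 j); lia.
Qed.

(** Rearranges the one-line word by positions; signs travel with their values, so the number of
    negative entries is kept. *)
Definition sperm_act w (y : {perm 'I_n}) : sperm n :=
  ((y * w.1)%g, [ffun i => w.2 (y i)]).

Lemma sval_act w y i : sval (sperm_act w y) i = sval w (y i).
Proof. by rewrite /sval /= ffunE permM. Qed.

Lemma sperm_act1 w : sperm_act w 1%g = w.
Proof.
by case: w => s neg; rewrite /sperm_act mul1g; congr (_, _); apply/ffunP => i;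
  rewrite ffunE perm1.
Qed.

Lemma sperm_actM w y z : sperm_act (sperm_act w y) z = sperm_act w (z * y)%g.
Proof.
by rewrite /sperm_act mulgA; congr (_, _); apply/ffunP => i; rewrite !ffunE permM.
Qed.

Lemma sperm_actK y : cancel (sperm_act^~ y) (sperm_act^~ (y^-1)%g).
Proof. by move=> w; rewrite sperm_actM mulVg sperm_act1. Qed.

Lemma sperm_actVK y : cancel (sperm_act^~ (y^-1)%g) (sperm_act^~ y).
Proof. by move=> w; rewrite sperm_actM mulgV sperm_act1. Qed.

Lemma card_neg_act w y : #|[set i | (sperm_act w y).2 i]| = #|[set i | w.2 i]|.
Proof.
rewrite -(card_preimset [set i | w.2 i] (@perm_inj _ y)).
by apply: eq_card => i; rewrite !inE ffunE.
Qed.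

Lemma block_permsV (c : 'I_n -> nat) y : y \in block_perms c -> y^-1%g \in block_perms c.
Proof.
by rewrite !inE => /forallP yB; apply/forallP => i; rewrite -(eqP (yB _)) permKV.
Qed.

(* Each orbit of the block-preserving position permutations, which act freely,
   contains exactly one block-increasing arrangement. *)
Lemma card_block_increasing (W : {set sperm n}) (c : 'I_n -> nat) :
  (forall i j : 'I_n, i <= j -> c i <= c j) ->
  (forall w y, w \in W -> y \in block_perms c -> sperm_act w y \in W) ->
  #|[set w in W | block_increasing c (sval w)]| * #|block_perms c| = #|W|.
Proof.
move=> c_homo W_act; pose inc w := block_increasing c (sval w).
have incE w (y : {perm 'I_n}) : block_increasing c (sval w \o y) = inc (sperm_act w y).
  by apply: eq_forallb => i; apply: eq_forallb => j; rewrite !sval_act.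
(* Double count of the pairs (w, y) whose rearrangement is increasing: each w admits exactly one y,
   and for fixed y the map w to w rearranged by y permutes W. *)
transitivity (\sum_(w in W) \sum_(y in block_perms c) inc (sperm_act w y)); last first.
  rewrite -sum1_card; apply: eq_bigr => w _.
  rewrite -[RHS](unique_block_sort (@sval_inj w) c_homo) -sum1dep_card.
  by rewrite big_mkcondr; apply: eq_bigr => y _; rewrite incE; case: (inc _).
rewrite exchange_big mulnC -sum_nat_const; apply: eq_bigr => y yB.
rewrite -sum1dep_card big_mkcondr /=.
rewrite (reindex_onto (sperm_act^~ y) (sperm_act^~ (y^-1)%g)) => [|w _] /=; last first.
  exact: sperm_actVK.
apply: eq_big => [w|w _]; last by rewrite /inc; case: block_increasing.
rewrite sperm_actK eqxx andbT; apply/idP/idP => wW; last exact: W_act.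
by rewrite -[w](sperm_actK y) W_act // block_permsV.
Qed.

Lemma card_even_neg : 0 < n ->
  #|[set w : sperm n | sp_even w]| = n`! * 2 ^ (n - 1).
Proof.
move=> n_gt0.
have -> : [set w : sperm n | sp_even w] =
    setX [set: {perm 'I_n}] [set neg : {ffun 'I_n -> bool} | ~~ odd #|[set o | neg o]|].
  by apply/setP => w; rewrite !inE.
rewrite cardsX cardsT card_Sn; congr (_ * _).
have := @card_subsets_parity 'I_n setT false; rewrite cardsT card_ord => <-; last first.
  by rewrite -card_gt0 cardsT card_ord.
apply: (@card_bij_on _ _ _ _ (fun neg : {ffun 'I_n -> bool} => [set o | neg o])
  (fun U : {set 'I_n} => [ffun o => o \in U])).
- by move=> neg; rewrite !inE subsetT eqbF_neg.
- move=> U; rewrite !inE subsetT eqbF_neg /=.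
  by congr (~~ odd #|pred_of_set _|); apply/setP => o; rewrite inE ffunE.
- by move=> neg _; apply/ffunP => o; rewrite ffunE inE.
- by move=> U _; apply/setP => o; rewrite inE ffunE.
Qed.

Lemma card_neg_off (A : {set 'I_n}) :
  #|[set w : sperm n | [forall i in A, ~~ w.2 i]]| = n`! * 2 ^ (n - #|A|).
Proof.
have -> : [set w : sperm n | [forall i in A, ~~ w.2 i]] =
    setX [set: {perm 'I_n}] [set neg | neg \in pffun_on false (mem (~: A)) predT].
  apply/setP => w; rewrite !inE /=; apply/forallP/pffun_onP => [negA|[negA _] i].
    split; last by move=> b _.
    apply/subsetP => i; rewrite !inE eqbF_neg negbK => wi.
    by apply/negP => /(implyP (negA i)); rewrite wi.
  apply/implyP => iA; apply/negP => wi.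
  by have /subsetP/(_ i) := negA; rewrite !inE wi iA => /(_ isT).
rewrite cardsX cardsT card_Sn; congr (_ * _).
by rewrite cardsE card_pffun_on card_bool -[#|mem _|]/#|~: A| cardsCs setCK card_ord.
Qed.

End SignedPerm.

(** * Descent conditions as increasing conditions on blocks *)

Section Descents.
Variables (n : nat) (a : seq nat).
Hypotheses (n_ge2 : 2 <= n) (a_pcomp : is_pcomp n a).
Let o0 : 'I_n := Ordinal (ltnW n_ge2).
Let o1 : 'I_n := Ordinal n_ge2.

(** For i > 0 outside D(a), positions i and i+1 share a block and must increase. The absence of a
    descent at 0 reads w(1) + w(2) > 0, strictly because w(1) and w(2) have distinct absolute
    values. *)
Lemma Dw_subset w :
  (Dw w \subset Dc n a) =
  ((0 \in psums a) || (0 < sval w o0 + sval w o1)%R) &&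
    block_increasing (fun i : 'I_n => block_of a i) (sval w).
Proof.
apply/subsetP/andP => [sub|[sub0 /forallP inc] i].
  split.
    have [//|no0] := boolP (0 \in psums a); have := sub o0; rewrite !inE /= (negbTE no0).
    rewrite (wvalS w o0) (@wval0 _ w o1) // => /contraFN/(_ erefl); rewrite -leNgt.
    have := @sval_inj _ w o0 o1; rewrite /sval.
    have : w.1 o0 != w.1 o1 by rewrite (inj_eq perm_inj).
    rewrite -val_eqE /=; case: (w.2 o0); case: (w.2 o1); lia.
  apply/forallP => i; apply/forallP => j; apply/implyP => /andP[/eqP ji /eqP cij].
  have := sub j; rewrite !inE (wvalS w j).
  have jE : \val j = i.+1 := ji.
  have -> : wval w j = sval w i by rewrite -(wvalS w i) -jE.
  rewrite jE => sub_j.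
  have j_notin : i.+1 \notin psums a.
    by apply/negP => ji_in; move: cij; rewrite ji (block_ofS a_pcomp) ji_in; lia.
  rewrite lt_neqAle (inj_eq (@sval_inj _ w)) -val_eqE jE /=; apply/andP; split; first by lia.
  by rewrite leNgt; apply: contraNN j_notin.
rewrite !inE; case: i => [[|i] i_lt] /=.
  rewrite (wvalS w o0) (@wval0 _ w o1) //; move: sub0; case: (0 \in _) => //=.
  by move: (sval w o0) (sval w o1) => x y; lia.
pose i' := Ordinal (ltnW i_lt).
rewrite (wvalS w (Ordinal i_lt)) -[i]/(val i') wvalS.
have /forallP/(_ (Ordinal i_lt)) := inc i'.
rewrite /= eqxx /= (block_ofS a_pcomp); case: (i.+1 \in _) => //=.
by rewrite addn0 eqxx /= => /lt_trans lt_w /lt_w; rewrite ltxx.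
Qed.

End Descents.

(** The number N(U) for U = D(a). *)
Definition card_Dw_sub n (a : seq nat) : nat :=
  #|[set w : sperm n | sp_even w && (Dw w \subset Dc n a)]|.

Lemma odd_card_set (T : finType) (f : T -> bool) :
  odd #|[set o | f o]| = \big[addb/false]_o f o.
Proof.
rewrite -sum1dep_card big_mkcond /= (big_morph odd oddD (erefl : odd 0 = false)).
by apply: eq_bigr => o _; case: (f o).
Qed.

Lemma psums_cons2 (x y : nat) (r : seq nat) :
  psums (x :: y :: r) = x :: [seq x + d | d <- psums (y :: r)].
Proof.
rewrite /psums /= addn0 -[2]/(1 + 1) iotaDl -!map_comp.
by congr (_ :: _); apply: eq_in_map => -[|j].
Qed.

Lemma psums_succ_head (x : nat) (r : seq nat) :
  psums (x.+1 :: r) = [seq d.+1 | d <- psums (x :: r)].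
Proof.
case: r => [|y r]; first by [].
by rewrite !psums_cons2 /= -map_comp; congr (_ :: _); apply: eq_map => d /=; lia.
Qed.

Section Counts.
Variables (n : nat) (a : seq nat).
Hypotheses (n_ge2 : 2 <= n) (a_pcomp : is_pcomp n a).
Let o0 : 'I_n := Ordinal (ltnW n_ge2).
Let o1 : 'I_n := Ordinal n_ge2.
Let blk (i : 'I_n) := block_of a i.

(** Cancels the order of the block-preserving group, turning an orbit count into a multinomial
    formula. *)
Lemma multinom_of_mul (N M : nat) :
  N * \prod_(x <- a) x`! = n`! * M -> N = multinom n a * M.
Proof.
have prod_gt0 := prod_fact_gt0 a.
have := multinom_fact a; rewrite (pcomp_sumn a_pcomp) => <-.
by rewrite mulnAC => /eqP; rewrite eqn_pmul2r // => /eqP.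
Qed.

Lemma mem0_psums : (0 \in psums a) = (head 0 a == 0).
Proof.
case: a a_pcomp => [|x [|y r]] /and3P[] //= _.
  by rewrite addn0 => _ /eqP->; rewrite eqn0Ngt ltnW.
move=> _ _; rewrite psums_cons2 inE [0 == x]eq_sym; case: x => [|x] //=.
by apply/mapP => -[d].
Qed.

Lemma block_of_homo_ord (i j : 'I_n) : i <= j -> blk i <= blk j.
Proof. exact: block_of_homo. Qed.

Lemma block_perms_blk (i : 'I_n) y : y \in block_perms blk -> blk (y i) = blk i.
Proof. by rewrite inE => /forallP/(_ i)/eqP. Qed.

(** Here 0 lies in D(a), so w(1) + w(2) is unconstrained and the orbit count applies to all even
    signed permutations. *)
Lemma card_Dw_sub_head0 : head 0 a = 0 -> card_Dw_sub n a = multinom n a * 2 ^ (n - 1).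
Proof.
move=> a0; apply: multinom_of_mul; rewrite -(card_block_perms_pcomp a_pcomp).
rewrite -card_even_neg; last exact: ltnW.
rewrite -(@card_block_increasing n [set w | sp_even w] blk); first last.
- by move=> w y; rewrite !inE /sp_even card_neg_act.
- exact: block_of_homo_ord.
congr (_ * _); apply: eq_card => w; rewrite !inE.
by rewrite (Dw_subset n_ge2 a_pcomp) mem0_psums a0.
Qed.

Section LargeHead.
Hypothesis head_gt1 : 1 < head 0 a.

Let size_a : 0 < size a := pcomp_size_gt0 a_pcomp.

Lemma block0E (i : 'I_n) : (blk i == 0) = (i < head 0 a).
Proof.
by rewrite -leqn0 (block_of_le a_pcomp) // sumn_takeS take0 nth0.
Qed.

(** From w(1) < w(2) and w(1) + w(2) > 0 follows w(2) > 0, and positivity propagates along the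
    increasing first block. *)
Lemma block_positive (w : sperm n) (i : 'I_n) :
  (0 < sval w o0 + sval w o1)%R -> block_increasing blk (sval w) ->
  blk i = 0 -> i != o0 -> (0 < sval w i)%R.
Proof.
move=> sum_gt0 /forallP inc.
have incP (x y : 'I_n) : y = x.+1 :> nat -> blk x = blk y -> (sval w x < sval w y)%R.
  by move=> xy bxy; have /forallP/(_ y) := inc x; rewrite xy bxy !eqxx.
case: i => i; elim: i => [|[|i] IHi] i_lt; first by rewrite -val_eqE.
  move=> _ _; have -> : Ordinal i_lt = o1 by apply: val_inj.
  have lt01 : (sval w o0 < sval w o1)%R.
    apply: incP => //; apply/eqP.
    by rewrite (eqP (_ : blk o0 == 0)) ?[0 == _]eq_sym block0E //= ltnW.
  by move: lt01 sum_gt0; move: (sval w o0) (sval w o1) => x y; lia.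
move=> blk_i _; have i'_lt := ltnW i_lt.
have blk_i' : blk (Ordinal i'_lt) = 0.
  by apply/eqP; move/eqP: blk_i; rewrite !block0E /=; exact: ltnW.
apply: lt_trans (IHi i'_lt blk_i' isT) _.
by apply: incP; rewrite ?blk_i ?blk_i'.
Qed.

(** The permutations counted correspond to block-increasing ones of any parity with positive first
    block [A]. Positivity on [A] is stable under block-preserving rearrangement, so the orbit count
    applies with n! * 2^(n - |A|) in total. *)
Lemma card_Dw_sub_head_gt1 : card_Dw_sub n a = multinom n a * 2 ^ (n - head 0 a).
Proof.
apply: multinom_of_mul; rewrite -(card_block_perms_pcomp a_pcomp).
pose A := [set i : 'I_n | blk i == 0].
have o0A : blk o0 == 0 by rewrite block0E //= ltnW.
have o1A : blk o1 == 0 by rewrite block0E.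
have cardA : #|A| = head 0 a by rewrite (card_block a_pcomp) ?nth0.
rewrite -cardA -card_neg_off.
rewrite -(@card_block_increasing n _ blk); first last.
- move=> w y wA yB; move: wA; rewrite !inE => /forallP wA; apply/forallP => i; apply/implyP.
  by rewrite inE ffunE => i0; have := wA (y i); rewrite inE block_perms_blk // i0.
- exact: block_of_homo_ord.
congr (_ * _).
pose sgn0 (w : sperm n) (b : bool) : sperm n :=
  (w.1, [ffun o => if o == o0 then b else w.2 o]).
(* The parity of the signs beyond w(1), which is the sign that w(1) must carry for w to be even. *)
pose rest (w : sperm n) := odd #|[set o | (o != o0) && w.2 o]|.
have rest_sgn0 w b : rest (sgn0 w b) = rest w.
  congr odd; apply: eq_card => o; rewrite !inE ffunE; case: eqP => //.
have oddE (w : sperm n) : odd #|[set o | w.2 o]| = w.2 o0 (+) rest w.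
  rewrite (cardsD1 o0) inE oddD oddb; congr (_ (+) odd _).
  by apply: eq_card => o; rewrite !inE.
have sval_sgn0 w b o : sval (sgn0 w b) o =
    if o == o0 then (if b then - `|sval w o0| else `|sval w o0|)%R else sval w o.
  rewrite /sval /= ffunE; case: eqP => // ->; case: b; case: (w.2 o0) => //=; lia.
have sgn0K (w : sperm n) (b : bool) : w.2 o0 = b -> sgn0 w b = w.
  case: w => s neg /= <-; congr (_, _); apply/ffunP => o.
  by rewrite ffunE; case: eqP => // ->.
have no0 : (0 \in psums a) = false by rewrite mem0_psums; case: head head_gt1.
(* Making w(1) positive loses only a sign, which the parity of the remaining
   signs restores. *)
apply: (@card_bij_on _ _ _ _ (fun w => sgn0 w false) (fun w => sgn0 w (rest w))).
- move=> w; rewrite !inE (Dw_subset n_ge2 a_pcomp) no0 /= => /and3P[w_even sum_gt0 inc].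
  apply/andP; split.
    apply/forallP => i; apply/implyP; rewrite inE ffunE => /eqP i0.
    case: ifP => // /negbT io0.
    have := block_positive sum_gt0 inc i0 io0; rewrite /sval.
    by case: (w.2 i) => //; lia.
  apply/forallP => i; apply/forallP => j; apply/implyP => ij.
  have := forallP (forallP inc i) j; rewrite ij /= !sval_sgn0.
  case/andP: ij => /eqP ji _.
  have -> : (j == o0) = false by rewrite -val_eqE /= ji.
  case: eqP => [io0|//]; have -> : j = o1 by apply: val_inj; rewrite /= ji io0.
  (* Only the comparison of w(1) with w(2) changes, and the two inequalities on them give |w(1)| <
     w(2). *)
  by rewrite io0; move: sum_gt0; move: (sval w o0) (sval w o1) => x y; lia.
- move=> w; rewrite !inE (Dw_subset n_ge2 a_pcomp) no0 /= => /andP[/forallP wA inc].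
  have w0 : w.2 o0 = false by apply/negbTE/(implyP (wA o0)); rewrite inE.
  have lt01 : (sval w o0 < sval w o1)%R.
    have := forallP (forallP inc o0) o1.
    by rewrite /= (eqP o0A) (eqP o1A) eqxx.
  have gt0 : (0 < sval w o0)%R by rewrite /sval w0.
  apply/and3P; split.
  + by rewrite /sp_even oddE rest_sgn0 ffunE eqxx addbb.
  (* Since 0 < w(1) < w(2), the sum stays positive for either sign of w(1). *)
  + rewrite !sval_sgn0 eqxx; have -> : (o1 == o0) = false by rewrite -val_eqE.
    by case: (rest w); move: lt01 gt0; move: (sval w o0) (sval w o1) => x y; lia.
  apply/forallP => i; apply/forallP => j; apply/implyP => ij.
  have := forallP (forallP inc i) j; rewrite ij /= !sval_sgn0.
  case/andP: ij => /eqP ji _.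
  have -> : (j == o0) = false by rewrite -val_eqE /= ji.
  case: eqP => [io0|//]; have -> : j = o1 by apply: val_inj; rewrite /= ji io0.
  by rewrite io0; case: (rest w); move: gt0; move: (sval w o0) (sval w o1) => x y; lia.
- move=> w; rewrite inE => /andP[w_even _]; rewrite rest_sgn0.
  rewrite -[RHS](sgn0K _ (rest w)) /sgn0 /=.
    by congr (_, _); apply/ffunP => o; rewrite !ffunE; case: eqP.
  by move: w_even; rewrite /sp_even oddE; case: (w.2 o0); case: (rest w).
- move=> w; rewrite !inE => /andP[/forallP wA _].
  rewrite -[RHS](sgn0K _ false) /sgn0 /=.
    by congr (_, _); apply/ffunP => o; rewrite !ffunE; case: eqP.
  by apply/negbTE/(implyP (wA o0)); rewrite inE.
Qed.

End LargeHead.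
End Counts.

(** * The diagram automorphism and the case of first part 1 *)

Section Swap.
Variable n : nat.
Hypothesis n_ge2 : 2 <= n.
Let o0 : 'I_n := Ordinal (ltnW n_ge2).
Let o1 : 'I_n := Ordinal n_ge2.

(* Conjugation by the sign change of 1: it induces the diagram automorphism of
   D_n that exchanges the nodes 0 and 1. *)
Definition sperm_flip (w : sperm n) : sperm n :=
  (w.1, [ffun o => w.2 o (+) ((o == o0) (+) (w.1 o == o0))]).

Lemma sperm_flipK : involutive sperm_flip.
Proof.
case=> s neg; rewrite /sperm_flip /=; congr (_, _); apply/ffunP => o.
by rewrite !ffunE addbK.
Qed.

(** Signs are toggled at the first position and at the position of the value 1 or -1: two toggles,
    which cancel if the positions coincide. *)
Lemma sp_even_flip w : sp_even (sperm_flip w) = sp_even w.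
Proof.
rewrite /sp_even !odd_card_set; congr negb.
under eq_bigr do rewrite ffunE.
have count1 (x : 'I_n) : \big[addb/false]_o (o == x) = true.
  by rewrite -odd_card_set cardsE card1.
have count2 : \big[addb/false]_o (w.1 o == o0) = true.
  apply: etrans (count1 (w.1^-1%g o0)); apply: eq_bigr => o _.
  by apply/eqP/eqP => [<-|->]; rewrite ?permK ?permKV.
by rewrite !big_split /= count1 count2 addbF.
Qed.

(** Negating w(1) exchanges the conditions w(1) > w(2) and -w(2) > w(1). Negating the entry of
    absolute value 1 alters no comparison with another entry, whose absolute value is at least 2. *)
Lemma Dw_flip w (i : 'I_n) : (i \in Dw (sperm_flip w)) = (tperm o0 o1 i \in Dw w).
Proof.
have s01 : w.1 o0 != w.1 o1 by rewrite (inj_eq perm_inj).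
rewrite !inE; case: tpermP => [->|->|].
- rewrite (wvalS _ o0) (@wval0 _ _ o1) // (wvalS _ o1) (wvalS _ o0).
  move: s01; rewrite /sval /= !ffunE -!val_eqE /=.
  move: (nat_of_ord (w.1 o0)) (nat_of_ord (w.1 o1)) => x y.
  by case: (w.2 o0); case: (w.2 o1); case: x y => [|x] [|y] //=; lia.
- rewrite (wvalS _ o1) (wvalS _ o0) (wvalS _ o0) (@wval0 _ _ o1) //.
  move: s01; rewrite /sval /= !ffunE -!val_eqE /=.
  move: (nat_of_ord (w.1 o0)) (nat_of_ord (w.1 o1)) => x y.
  by case: (w.2 o0); case: (w.2 o1); case: x y => [|x] [|y] //=; lia.
case: i => -[|[|i]] i_lt; first by case; apply: val_inj.
  by move=> _; case; apply: val_inj.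
move=> _ _.
pose j := Ordinal (ltnW i_lt).
have sij : w.1 (Ordinal i_lt) != w.1 j.
  by rewrite (inj_eq perm_inj) -val_eqE /=; lia.
rewrite !(wvalS _ (Ordinal i_lt)) -[i.+2 as X in wval _ X]/(val j).+1 !(wvalS _ j).
move: sij; rewrite /sval /= !ffunE -!val_eqE /=.
move: (nat_of_ord (w.1 _)) (nat_of_ord (w.1 j)) => x y.
by case: (w.2 _); case: (w.2 _); case: x y => [|x] [|y] //=; lia.
Qed.

(** The two compositions have the same partial sums except that 1 becomes 0, which is the exchange
    realised by [sperm_flip]. *)
Lemma card_Dw_sub_head1 (b2 : nat) (r : seq nat) : is_pcomp n [:: 1, b2 & r] ->
  card_Dw_sub n [:: 1, b2 & r] = card_Dw_sub n [:: 0, b2.+1 & r].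
Proof.
case/and3P=> _ /= /andP[b2_gt0 _] _.
have DcE (i : 'I_n) : (i \in Dc n [:: 0, b2.+1 & r]) = (tperm o0 o1 i \in Dc n [:: 1, b2 & r]).
  have ps_gt0 d : d \in psums (b2 :: r) -> 0 < d.
    case: (r) => [|y r']; first by [].
    by rewrite psums_cons2 inE => /predU1P[->//|/mapP[e _ ->]]; lia.
  rewrite !in_set !psums_cons2 psums_succ_head.
  have -> : [seq 0 + d | d <- [seq d.+1 | d <- psums (b2 :: r)]] =
     [seq 1 + d | d <- psums (b2 :: r)] by rewrite -map_comp.
  have no1 (m : nat) : m < 2 -> (m \in [seq 1 + d | d <- psums (b2 :: r)]) = false.
    by move=> m_lt; apply/mapP => -[d /ps_gt0]; lia.
  rewrite !inE; case: tpermP => [->|->|] /=; [by []|by rewrite !no1|].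
  by move=> /eqP/negbTE i0 /eqP/negbTE i1; move: i0 i1; rewrite -!val_eqE /= => -> ->.
rewrite /card_Dw_sub; apply: (@card_bij_on _ _ _ _ sperm_flip sperm_flip).
- move=> w; rewrite !inE sp_even_flip => /andP[-> /subsetP sub] /=.
  by apply/subsetP => i; rewrite Dw_flip DcE => /sub.
- move=> w; rewrite !inE sp_even_flip => /andP[-> /subsetP sub] /=.
  apply/subsetP => i; rewrite Dw_flip => /sub; by rewrite DcE tpermK.
- by move=> w _; rewrite sperm_flipK.
- by move=> w _; rewrite sperm_flipK.
Qed.

End Swap.

(** * Reduction modulo p *)

Section Moebius.
Local Open Scope ring_scope.
Variables (R : comNzRingType) (T : finType).

(** Expansion over subsets J of the product of F i + G i, where J collects the indices taking F.
    Each factor is 1 if U and S agree at i, and 0 otherwise. *)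
Lemma moebius_subsets (U S : {set T}) :
  \sum_(J : {set T} | (J \subset S) && (U \subset J)) (-1) ^+ (#|S| - #|J|)%N =
  (U == S)%:R :> R.
Proof.
pose F i : R := (i \in S)%:R.
pose G i : R := (i \notin U)%:R * (-1) ^+ (i \in S).
transitivity (\prod_i (F i + G i)); last first.
  case: eqVneq => [US|US].
    apply: big1 => i _; rewrite /F /G US.
    by case: (i \in S); rewrite /= ?mul0r ?mul1r ?addr0 ?add0r.
  have [i iUS] : exists i, (i \in U) != (i \in S).
    apply/existsP; apply: contraNT US; rewrite negb_exists => /forallP eqUS.
    by apply/eqP/setP => i; have := eqUS i; rewrite negbK => /eqP.
  rewrite (bigD1 i) //= /F /G.
  by case: (i \in U) (i \in S) iUS => [] [] //= _; rewrite ?mul0r ?mul1r ?addr0 ?subrr ?mul0r.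
rewrite bigA_distr [RHS](bigID (fun J : {set T} => (J \subset S) && (U \subset J))) /=.
rewrite [X in _ = _ + X]big1 ?addr0 => [|J]; last first.
  rewrite negb_and => /orP[/subsetPn[i iJ iS]|/subsetPn[i iU iJ]].
    by rewrite (bigD1 i) //= iJ /F (negbTE iS) mul0r.
  by rewrite (bigD1 i) //= (negbTE iJ) /G iU !mul0r.
apply: eq_bigr => J /andP[JS UJ].
rewrite -(cardsDS JS) -prodr_const [RHS](bigID (mem (S :\: J))) /=.
rewrite [X in _ = _ * X]big1 ?mulr1 => [|i]; last first.
  rewrite !inE negb_and negbK /F /G => /orP[iJ|iS]; first by rewrite iJ (subsetP JS).
  rewrite (negbTE iS) ifN; last by apply: contra iS; exact: (subsetP JS).
  have -> : i \notin U by apply: contra iS => iU; apply/(subsetP JS)/(subsetP UJ).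
  by rewrite mulr1.
apply: eq_bigr => i; rewrite inE /G => /andP[iJ iS].
have -> : i \notin U by apply: contra iJ; exact: (subsetP UJ).
by rewrite (negbTE iJ) iS mul1r expr1.
Qed.

Lemma moebius_card (W : finType) (P : pred W) (D : W -> {set T}) (S : {set T}) :
  #|[set w | P w && (D w == S)]|%:R =
  \sum_(U : {set T} | U \subset S)
    (-1) ^+ (#|S| - #|U|)%N * #|[set w | P w && (D w \subset U)]|%:R :> R.
Proof.
have cardE (Q : pred W) : #|[set w | P w && Q w]|%:R = \sum_(w | P w) (Q w)%:R :> R.
  rewrite -sum1dep_card natr_sum big_mkcondr /=.
  by apply: eq_bigr => w _; case: (Q w).
rewrite cardE; under [RHS]eq_bigr => U _ do rewrite cardE mulr_sumr.
rewrite exchange_big /=; apply: eq_bigr => w _.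
rewrite -moebius_subsets big_mkcondr /=; apply: eq_bigr => U _.
by case: (D w \subset U); rewrite ?mulr1 ?mulr0.
Qed.

End Moebius.

(** Transports sums over the listed pseudo-compositions to sums over subsets, through the bijection
    [Dc]. *)
Lemma big_pcomp (R : Type) (idx : R) (op : Monoid.com_law idx) (n : nat)
  (L : seq (seq nat)) (P : pred (seq nat)) (F : seq nat -> R) :
  uniq L -> (forall a, (a \in L) = is_pcomp n a) ->
  \big[op/idx]_(b <- L | P b) F b =
  \big[op/idx]_(S : {set 'I_n} | P (pcomp_of_set S)) F (pcomp_of_set S).
Proof.
move=> L_uniq L_mem; rewrite -(big_map (@pcomp_of_set n) P F).
apply: perm_big; apply: uniq_perm => //.
  by rewrite map_inj_uniq ?index_enum_uniq //; exact: can_inj (@pcomp_of_setK n).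
move=> a; rewrite L_mem; apply/idP/mapP => [a_pcomp|[S _ ->]].
  by exists (Dc n a); rewrite ?mem_index_enum ?DcK.
exact: pcomp_of_set_pcomp.
Qed.

(** * The counts N(U) modulo p and the set P *)

Section ModP.
Variables (p n k : nat) (nd : nat -> nat).
Hypotheses (p_pr : prime p) (p_odd : odd p) (n_ge4 : 4 <= n).
Hypotheses (nd_lt : forall j, nd j < p) (nE : n = \sum_(j < k.+1) nd j * p ^ j).

Let p_gt0 : 0 < p := prime_gt0 p_pr.
Let n_ge2 : 2 <= n := ltn_trans (isT : 1 < 3) n_ge4.

Lemma n_lt_exp : n < p ^ k.+1.
Proof. by rewrite {1}nE sum_digits_lt. Qed.

Lemma digit_n (j : nat) : j < k.+1 -> digit p j n = nd j.
Proof. by move=> j_lt; rewrite {1}nE digit_sum. Qed.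

Lemma natr_Fp_mod (a b : nat) : a = b %[mod p] -> (a%:R = b%:R :> 'F_p)%R.
Proof. by move=> ab; rewrite -(Fp_nat_mod p_pr) ab Fp_nat_mod. Qed.

Local Open Scope ring_scope.

(** By Fermat's little theorem, raising to the power p^j is the identity of ['F_p]. *)
Lemma expr_digits (x : 'F_p) (e : nat -> nat) (K : nat) :
  x ^+ (\sum_(j < K) e j * p ^ j)%N = \prod_(j < K) x ^+ e j.
Proof.
have frob (y : 'F_p) (j : nat) : y ^+ (p ^ j) = y.
  elim: j => [|j IHj]; first by rewrite expr1.
  by rewrite expnSr exprM IHj -(natr_Zp y) -natrX; apply/natr_Fp_mod/fermat_little.
elim: K => [|K IHK]; first by rewrite !big_ord0.
by rewrite !big_ord_recr /= exprD IHK exprM frob.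
Qed.

Lemma two_neq0 : (2 : 'F_p) != 0.
Proof.
rewrite -[2 : 'F_p]/(2%:R) -(dvdn_pcharf (pchar_Fp p_pr)).
by apply/negP => /dvdn_leq => /(_ isT); case: p p_odd p_pr => [|[|[]]].
Qed.

Lemma multinom_digits (s : seq nat) : sumn s = n ->
  (multinom n s)%:R = \prod_(j < k.+1) (multinom (nd j) (digs p j s))%:R :> 'F_p.
Proof.
move=> s_sum; rewrite -natr_prod; apply: natr_Fp_mod.
rewrite (lucas_multinom p_pr n_lt_exp s_sum).
by congr (_ %% _)%N; apply: eq_bigr => j _; rewrite digit_n.
Qed.

Lemma bprime_pcomp (b : seq nat) : is_pcomp n b -> is_pcomp n (bprime b).
Proof.
case: b => [|[|[|x]] [|y r]] // /and3P[_ /= /andP[_ r_pos] s_sum].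
by apply/and3P; split.
Qed.

Lemma head_bprime (b : seq nat) : is_pcomp n b -> (head 0 b <= 1)%N -> head 0 (bprime b) = 0%N.
Proof.
case: b => [|[|[|x]] [|y r]] // /and3P[_ _ /eqP /= nE'].
(* What remains is the one-part sequence 1, fixed by [bprime] but excluded by the size of n. *)
by move: n_ge4; rewrite -nE'.
Qed.

Lemma card_Dw_sub_bprime (b : seq nat) : is_pcomp n b ->
  card_Dw_sub n b = card_Dw_sub n (bprime b).
Proof.
by case: b => [|[|[|x]] [|y r]] //; exact: (card_Dw_sub_head1 n_ge2).
Qed.

Lemma nu_eq0 (b : seq nat) (j : 'I_k.+1) :
  sumn (digs p j (bprime b)) != nd j -> nu p k nd b = 0.
Proof.
move=> /negbTE j_neq; rewrite /nu; case: ifP => _.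
  by rewrite (bigD1 j) //= /multinom j_neq mulr0 !mul0r mulr0.
by rewrite (bigD1 j) //= /multinom j_neq mulr0 mul0r.
Qed.

(** The closed formulas for N(U) split digit by digit: the multinomial by Lucas, the power of 2 by
    Fermat. *)
Lemma card_Dw_sub_nu (b : seq nat) : is_pcomp n b ->
  (card_Dw_sub n b)%:R = nu p k nd b.
Proof.
move=> b_pcomp; have b'_pcomp := bprime_pcomp b_pcomp.
have [b_le1|b_gt1] := leqP (head 0%N b) 1.
  rewrite card_Dw_sub_bprime // card_Dw_sub_head0 ?head_bprime //.
  rewrite /nu b_le1 big_split /= -expr_digits -nE -multinom_digits ?(pcomp_sumn b'_pcomp) //.
  rewrite natrM natrX mulrC mulrA; congr (_ * _).
  by rewrite -{2}[n](@subnK 1) 1?ltnW // addn1 exprS mulKf ?two_neq0.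
have b'E : bprime b = b by case: b b_gt1 {b_pcomp b'_pcomp} => [|[|[|x]] r].
rewrite (card_Dw_sub_head_gt1 n_ge2) // natrM natrX multinom_digits ?(pcomp_sumn b_pcomp) //.
rewrite /nu leqNgt b_gt1 /= b'E big_split /= mulrC.
(* The exponent n - b_1 splits into digit differences only without borrows. If the digit sums fail
   somewhere, a multinomial factor makes both sides 0; otherwise b_1 is digitwise below n. *)
have [/forallP dig_ok|] := boolP [forall j : 'I_k.+1, sumn (digs p j b) == nd j]; last first.
  rewrite negb_forall => /existsP[j /negbTE j_neq].
  by rewrite [X in _ * X](bigD1 j) //= [in LHS]/multinom j_neq mul0r mulr0
             [X in _ = _ * X](bigD1 j) //= [in RHS]/multinom j_neq mul0r mulr0.
congr (_ * _).
have head_le (j : nat) : (j < k.+1)%N -> (digit p j (head 0 b) <= nd j)%N.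
  move=> j_lt; rewrite -(eqP (dig_ok (Ordinal j_lt))) /=.
  by case: (b) b_gt1 => //= x r _; rewrite leq_addr.
have head_lt : (head 0 b < p ^ k.+1)%N.
  rewrite (leq_ltn_trans _ n_lt_exp) // -(pcomp_sumn b_pcomp).
  by case: (b) b_gt1 => //= x r _; rewrite leq_addr.
rewrite {1}nE {1}(digit_expansion p_gt0 head_lt).
rewrite -(expr_digits 2 (fun j => (nd j - digit p j (head 0 b))%N)).
congr (_ ^+ _); apply/eqP.
rewrite -(eqn_add2r (\sum_(i < k.+1) digit p i (head 0 b) * p ^ i)%N).
rewrite subnK; last by apply: leq_sum => i _; rewrite leq_mul2r head_le ?orbT.
rewrite -big_split; apply/eqP/eq_bigr => i _ /=.
by rewrite -mulnDl subnK ?head_le.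
Qed.

(** The digit sums are not reduced modulo p, so carries do no harm. *)
Lemma digits_sumn (s : seq nat) (K : nat) : all (fun x => x < p ^ K)%N s ->
  sumn s = (\sum_(j < K) sumn (digs p j s) * p ^ j)%N.
Proof.
elim: s => [_|x s IHs /= /andP[x_lt s_lt]].
  by rewrite big1 // => j _; rewrite mul0n.
rewrite IHs // {1}(digit_expansion p_gt0 x_lt) -big_split.
by apply: eq_bigr => j _; rewrite mulnDl.
Qed.

(** Without carries, the digits of a partial sum are partial sums of digits. *)
Lemma digit_psums (s : seq nat) (d j : nat) : is_pcomp n s ->
  (forall i : 'I_k.+1, sumn (digs p i s) = nd i) ->
  d \in psums s -> (j < k.+1)%N -> (digit p j d <= nd j)%N.
Proof.
move=> s_pcomp s_dig /(nthP 0%N)[i]; rewrite size_psums => i_lt <- j_lt; rewrite nth_psums //.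
have digs_le (l : nat) : (l < k.+1)%N -> (sumn (digs p l (take i.+1 s)) <= nd l)%N.
  by move=> l_lt; rewrite -(s_dig (Ordinal l_lt)) /digs map_take leq_sumn_take_sumn.
rewrite (@digits_sumn _ k.+1).
  rewrite (@digit_sum p k.+1 (fun l => sumn (digs p l (take i.+1 s)))) ?digs_le //.
  by move=> l l_lt; apply: leq_ltn_trans (digs_le l l_lt) (nd_lt l).
apply/allP => x /mem_take x_in; apply: leq_ltn_trans n_lt_exp.
by rewrite -(pcomp_sumn s_pcomp) sumnE (big_rem x x_in) leq_addr.
Qed.

Local Close Scope ring_scope.

Lemma Pset_digits (x : 'I_n) :
  (x \in Pset p k nd n) = [forall j : 'I_k.+1, digit p j x <= nd j] || (val x == 1).
Proof.
rewrite inE (ltn_eqF (ltn_ord x)) andbT; congr (_ || _).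
apply/existsP/forallP => [[b /andP[/forallP b_le /eqP xE]] j|x_le].
  have -> : nat_of_ord x = (\sum_(i < k.+1) b (inord i) * p ^ i)%N.
    by rewrite [LHS]xE; apply: eq_bigr => i _; rewrite inord_val.
  rewrite (@digit_sum p k.+1 (fun i => b (inord i))) //.
  by rewrite inord_val; exact: b_le.
exists [ffun j : 'I_k.+1 => Ordinal (digit_lt j x p_gt0)]; apply/andP; split.
  by apply/forallP => j; rewrite ffunE; exact: x_le.
apply/eqP; rewrite [LHS](digit_expansion p_gt0 (ltn_trans (ltn_ord x) n_lt_exp)).
by apply: eq_bigr => j _; rewrite ffunE.
Qed.

(** Partial sums of b' are digitwise below n. D(b) has an element outside D(b') only if b_1 = 1, and
    that element is 1: hence the extra element of P. *)
Lemma Dc_sub_Pset (b : seq nat) : is_pcomp n b ->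
  (forall j : 'I_k.+1, sumn (digs p j (bprime b)) = nd j) ->
  Dc n b \subset Pset p k nd n.
Proof.
move=> b_pcomp b_dig; apply/subsetP => x; rewrite in_set Pset_digits => x_in.
have : (val x \in psums (bprime b)) || (val x == 1).
  case: b b_pcomp x_in {b_dig} => [|[|[|b1]] [|b2 r]] //=; try by move=> _ ->.
  rewrite !psums_cons2 psums_succ_head !inE -map_comp => _ /orP[->|x_in].
    by rewrite !orbT.
  by apply/orP; left; apply/orP; right.
case/orP=> [x_in'|->]; last by rewrite orbT.
by apply/orP; left; apply/forallP => j; apply: digit_psums x_in' _; rewrite ?bprime_pcomp.
Qed.

(** The range ['I_n.+1] includes n itself, so every choice of digits below those of n is
    realised. *)
Lemma card_digits_le :
  #|[set x : 'I_n.+1 | [forall j : 'I_k.+1, digit p j x <= nd j]]| =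
  \prod_(j < k.+1) (nd j).+1.
Proof.
have cardF (j : 'I_k.+1) : #|[pred b : 'I_p | b <= nd j]| = (nd j).+1.
  rewrite -[RHS](card_ord_lt (nd_lt j)) cardsE.
  by apply: eq_card => b; rewrite !inE.
transitivity #|family (fun j : 'I_k.+1 => [pred b : 'I_p | b <= nd j])|; last first.
  rewrite card_family -[RHS]big_enum /= /image_mem.
  by elim: (enum _) => [|j r IHr]; rewrite ?big_nil // big_cons /= cardF IHr.
have x_lt (x : 'I_n.+1) : x < p ^ k.+1 := leq_ltn_trans (leq_ord x) n_lt_exp.
have sum_le (b : {ffun 'I_k.+1 -> 'I_p}) : (forall j, b j <= nd j) ->
    \sum_(j < k.+1) b j * p ^ j < n.+1.
  by move=> b_le; rewrite ltnS [X in _ <= X]nE leq_sum // => j _; rewrite leq_mul2r b_le orbT.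
have digit_b (b : {ffun 'I_k.+1 -> 'I_p}) (j : 'I_k.+1) :
    digit p j (\sum_(j < k.+1) b j * p ^ j) = b j.
  rewrite -[in RHS](inord_val j).
  rewrite -(@digit_sum p k.+1 (fun i => b (inord i)) j) //.
  by congr digit; apply: eq_bigr => i _; rewrite inord_val.
apply: (@card_bij_on _ _ _ _
  (fun x : 'I_n.+1 => [ffun j : 'I_k.+1 => Ordinal (digit_lt j x p_gt0)])
  (fun b : {ffun 'I_k.+1 -> 'I_p} => inord (\sum_(j < k.+1) b j * p ^ j))).
- move=> x; rewrite inE => /forallP x_le; apply/familyP => j.
  by rewrite ffunE inE; exact: x_le.
- move=> b /familyP b_le; rewrite inE; apply/forallP => j.
  have b_le' i : b i <= nd i by exact: (b_le i).
  by rewrite inordK ?sum_le ?digit_b.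
- move=> x _; apply: val_inj; rewrite /= [RHS](digit_expansion p_gt0 (x_lt x)).
  rewrite inordK; last first.
    apply: leq_ltn_trans (ltn_ord x).
    by rewrite [X in _ <= X](digit_expansion p_gt0 (x_lt x)); apply: leq_sum => j _; rewrite ffunE.
  by apply: eq_bigr => j _; rewrite ffunE.
- move=> b /familyP b_le; apply/ffunP => j; apply: val_inj.
  have b_le' i : b i <= nd i by exact: (b_le i).
  by rewrite ffunE /= inordK ?sum_le ?digit_b.
Qed.

(** P arises from the numbers digitwise below n by adjoining 1 and removing n. The number 1 is new
    exactly when n_0 = 0, and then it makes up for the loss of n. *)
Lemma card_Pset :
  #|Pset p k nd n| =
    if nd 0 == 0 then \prod_(j < k.+1) (nd j).+1 else (\prod_(j < k.+1) (nd j).+1) - 1.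
Proof.
rewrite -card_digits_le.
set A := [set x | _].
have n_in : ord_max \in A.
  by rewrite inE; apply/forallP => j; rewrite /= digit_n.
have one_lt : 1 < n.+1 := ltnW n_ge2.
pose one := Ordinal one_lt.
have one_in : (one \in A) = (nd 0 != 0).
  rewrite inE -lt0n; apply/forallP/idP => [/(_ ord0)|nd0 j].
    by rewrite digit0 modn_small // prime_gt1.
  rewrite /digit; case: j => -[|j] j_lt /=; first by rewrite divn1 modn_small ?prime_gt1.
  by rewrite divn_small ?mod0n // -(exp1n j.+1) ltn_exp2r ?prime_gt1.
have -> : #|Pset p k nd n| = #|(one |: A) :\ ord_max|.
  have lift_inj : injective (widen_ord (leqnSn n)) by move=> i j /(congr1 val)/= /val_inj.
  rewrite -(card_imset _ lift_inj); apply: eq_card => x; rewrite !inE.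
  apply/imsetP/andP => [[y y_in ->]|[x_neq x_in]].
    rewrite Pset_digits in y_in; split; last by rewrite -val_eqE orbC.
    by rewrite -val_eqE /= ltn_eqF.
  have x_lt : x < n.
    by rewrite ltn_neqAle -ltnS ltn_ord andbT.
  exists (Ordinal x_lt); last exact: val_inj.
  by rewrite Pset_digits orbC.
have := cardsD1 ord_max (one |: A); rewrite in_setU n_in orbT cardsU1 one_in negbK.
by case: eqP => _ /=; lia.
Qed.

End ModP.

(** * Counting sign-twisted fibers *)

Lemma card_split_set (T : finType) (P : {set T}) (Q1 Q2 : pred {set T}) :
  #|[set S : {set T} | Q1 (S :&: P) && Q2 (S :\: P)]| =
  #|[set A : {set T} | (A \subset P) && Q1 A]| *
  #|[set B : {set T} | (B \subset ~: P) && Q2 B]|.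
Proof.
rewrite -cardsX; apply: (@card_bij_on _ _ _ _
  (fun S : {set T} => (S :&: P, S :\: P)) (fun AB : {set T} * {set T} => AB.1 :|: AB.2)).
- by move=> S; rewrite !inE /= => /andP[-> ->]; rewrite subsetIr setDE subsetIr.
- case=> A B; rewrite !inE /= => /andP[/andP[AP qA] /andP[BP qB]].
  have -> : (A :|: B) :&: P = A.
    by rewrite setIUl (setIidPl AP) [B :&: P](_ : _ = set0) ?setU0 //;
       apply/eqP; rewrite setI_eq0 disjoints_subset.
  have -> // : (A :|: B) :\: P = B; last by rewrite qA.
  rewrite setDUl (_ : A :\: P = set0) ?set0U; last by apply/eqP; rewrite setD_eq0.
  by rewrite setDE; apply/setIidPl.
- by move=> S _; rewrite /= setID.
- case=> A B; rewrite !inE /= => /andP[/andP[AP _] /andP[BP _]]; congr (_, _).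
    by rewrite setIUl (setIidPl AP) [B :&: P](_ : _ = set0) ?setU0 //;
       apply/eqP; rewrite setI_eq0 disjoints_subset.
  rewrite setDUl (_ : A :\: P = set0) ?set0U; last by apply/eqP; rewrite setD_eq0.
  by rewrite setDE; apply/setIidPl.
Qed.

Section SignedFibers.
Local Open Scope ring_scope.
Variables (F : fieldType) (T : finType) (P : {set T}) (r : {set T} -> F).
Hypothesis r_split : forall S, r S = (-1) ^+ #|S :\: P| * r (S :&: P).

(** The sign is immaterial if i = 0 and trivial if P is everything, so the part of S outside P is
    free. *)
Lemma card_fiber_full (i : F) : (i == 0) || (~: P == set0) ->
  #|[set S | r S == i]| = (2 ^ #|~: P| * #|[set A : {set T} | (A \subset P) && (r A == i)]|)%N.
Proof.
move=> i_or; rewrite mulnC -card_powerset.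
have -> : #|powerset (~: P)| = #|[set B : {set T} | (B \subset ~: P) && xpredT B]|.
  by apply: eq_card => B; rewrite !inE andbT.
rewrite -(card_split_set P (fun A => r A == i)); apply: eq_card => S; rewrite !inE andbT r_split.
case/orP: i_or => [/eqP->|/eqP P0]; first by rewrite mulf_eq0 signr_eq0.
by rewrite setDE P0 setI0 cards0 mul1r.
Qed.

(** An even part outside P requires the value i at S :&: P, an odd one the value -i. Each parity has
    the same number of choices, and i != -i keeps the two conditions disjoint. *)
Lemma card_fiber_half (i : F) : i != - i -> ~: P != set0 ->
  #|[set S | r S == i]| =
  (2 ^ (#|~: P| - 1) * #|[set A : {set T} | (A \subset P) && ((r A == i) || (r A == - i)%R)]|)%N.
Proof.
move=> i_neq P0.
pose part (b : bool) := [set S : {set T} | (r (S :&: P) == (-1) ^+ b * i) && (odd #|S :\: P| == b)].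
have part_card b : #|part b| =
    (#|[set A : {set T} | (A \subset P) && (r A == (-1) ^+ b * i)%R]| * 2 ^ (#|~: P| - 1))%N.
  rewrite (card_split_set P (fun A => r A == (-1) ^+ b * i) (fun B => odd #|B| == b)).
  by rewrite card_subsets_parity.
have -> : [set S | r S == i] = part false :|: part true.
  apply/setP => S; rewrite !inE r_split -signr_odd expr0 expr1 mul1r mulN1r.
  case: odd; rewrite ?andbF ?andbT ?orbF /= ?expr1 ?expr0 ?mulN1r ?mul1r //.
  by rewrite eqr_oppLR.
rewrite cardsU (_ : part false :&: part true = set0) ?cards0 ?subn0; last first.
  by apply/setP => S; rewrite !inE; case: odd; rewrite !andbF.
rewrite !part_card expr0 expr1 mul1r mulN1r -mulnDl mulnC; congr (_ * _)%N.
rewrite -[RHS]addn0 -(cards0 {set T}) -cardsUI; congr (_ + _)%N; congr #|pred_of_set _|.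
  by apply/setP => A; rewrite !inE -andb_orr.
apply/setP => A; rewrite !inE; case: eqP => [->|]; last by rewrite !andbF.
by rewrite (negbTE i_neq) !andbF.
Qed.

End SignedFibers.

(** * Ribbon numbers modulo p and the final count *)

Section Main.
Variables (p n k : nat) (nd : nat -> nat).
Hypotheses (p_pr : prime p) (p_odd : odd p) (n_ge4 : 4 <= n).
Hypotheses (nd_lt : forall j, nd j < p) (nd_k : 0 < nd k).
Hypothesis nE : n = \sum_(j < k.+1) nd j * p ^ j.

Let p_gt0 : 0 < p := prime_gt0 p_pr.
Local Notation P := (Pset p k nd n).

(** If all digits of n below the top are p - 1, only the top digit of x < n has to be compared, and
    division by p^k is monotone. *)
Lemma Pset_eqT : (~: P == set0) = [forall j : 'I_k, nd j == p.-1].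
Proof.
have p_gt2 : 2 < p by case: p p_odd p_pr => [|[|[]]].
rewrite -setCT (can_eq (@setCK _)) -subTset; apply/subsetP/forallP => [P_all j|nd_max x _].
  apply/negPn/negP => nd_neq.
  have nd_small : nd j < p.-1 by rewrite ltn_neqAle nd_neq -ltnS prednK ?nd_lt.
  (* If digit j of n is below p - 1, the number (p - 1) * p^j escapes P: it is less than p^k <= n,
     its digit j is too large, and it is not 1 because p > 2. *)
  have x_lt : p.-1 * p ^ j < n.
    have : p.-1 * p ^ j < p ^ k.
      apply: (@leq_trans (p ^ j.+1)); last by rewrite leq_exp2l ?prime_gt1.
      by rewrite expnS ltn_mul2r expn_gt0 p_gt0 ltn_predL p_gt0.
    move/leq_trans; apply; rewrite [X in _ <= X]nE big_ord_recr /=.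
    by rewrite (leq_trans _ (leq_addl _ _)) // leq_pmull.
  have := P_all (Ordinal x_lt) (in_setT _).
  rewrite (Pset_digits p_pr nd_lt nE) //= => /orP[/forallP|/eqP x1].
    move/(_ (widen_ord (leqnSn k) j)); rewrite /= /digit mulnK ?expn_gt0 ?p_gt0 //.
    by rewrite modn_small ?ltn_predL // leqNgt nd_small.
  have : p.-1 * 1 <= p.-1 * p ^ j by rewrite leq_mul2l expn_gt0 p_gt0 orbT.
  by rewrite x1 muln1; lia.
rewrite (Pset_digits p_pr nd_lt nE) //; apply/orP; left; apply/forallP => j.
have [jk|kj] := ltnP j k.
  by rewrite (eqP (nd_max (Ordinal jk))) -ltnS prednK // digit_lt.
have jE : j = k :> nat by apply/eqP; rewrite eqn_leq kj -ltnS ltn_ord.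
rewrite jE -(digit_n nd_lt nE (ltnSn k)) /digit !modn_small ?ltn_divLR ?expn_gt0 ?p_gt0 //.
- by rewrite leq_div2r // ltnW.
- by rewrite -expnS (n_lt_exp nd_lt nE).
- by rewrite -expnS (ltn_trans (ltn_ord x)) // (n_lt_exp nd_lt nE).
Qed.

Local Open Scope ring_scope.

(** The Moebius transform of [nu], to which both the ribbon numbers modulo p and [rDT] are
    reduced. *)
Definition ribD_mod (S : {set 'I_n}) : 'F_p :=
  \sum_(U : {set 'I_n} | U \subset S) (-1) ^+ (#|S| - #|U|)%N * nu p k nd (pcomp_of_set U).

Lemma ribD_modE (S : {set 'I_n}) : (ribD n (pcomp_of_set S))%:R = ribD_mod S.
Proof.
rewrite /ribD pcomp_of_setK (moebius_card _ (@sp_even n) (@Dw n) S).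
apply: eq_bigr => U _; rewrite -(card_Dw_sub_nu p_pr p_odd n_ge4 nd_lt nE) ?pcomp_of_set_pcomp //.
by rewrite /card_Dw_sub pcomp_of_setK.
Qed.

Lemma nu_Pset (U : {set 'I_n}) : ~~ (U \subset P) -> nu p k nd (pcomp_of_set U) = 0.
Proof.
move=> U_P; have U_pcomp := pcomp_of_set_pcomp U.
have [/forallP dig_ok|] :=
    boolP [forall j : 'I_k.+1, sumn (digs p j (bprime (pcomp_of_set U))) == nd j].
  case/negP: U_P; rewrite -{1}(pcomp_of_setK U).
  by apply: (Dc_sub_Pset p_pr nd_lt nE) => // j; apply/eqP.
by rewrite negb_forall => /existsP[j]; exact: nu_eq0.
Qed.

(** Only subsets U of P contribute, and these lie in S :&: P; the elements of S outside P affect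
    only the sign. *)
Lemma ribD_mod_split (S : {set 'I_n}) :
  ribD_mod S = (-1) ^+ #|S :\: P| * ribD_mod (S :&: P).
Proof.
rewrite /ribD_mod mulr_sumr [LHS](bigID (fun U : {set 'I_n} => U \subset P)) /=.
rewrite [X in _ + X]big1 ?addr0 => [|U /andP[_ U_P]]; last by rewrite nu_Pset ?mulr0.
apply: eq_big => [U|U /andP[US UP]]; first by rewrite subsetI.
rewrite mulrA -exprD; congr ((-1) ^+ _ * _).
have USP : (#|U| <= #|S :&: P|)%N by rewrite subset_leq_card // subsetI US.
by rewrite addnBA // addnC cardsID.
Qed.

(** The terms left out by the digit condition have [nu] equal to 0. *)
Lemma rDT_ribD_mod (L : seq (seq nat)) (T : {set 'I_n}) :
  uniq L -> (forall a, (a \in L) = is_pcomp n a) -> rDT p k nd L T = ribD_mod T.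
Proof.
move=> L_uniq L_mem; rewrite /rDT (big_pcomp _ _ _ L_uniq L_mem) /ribD_mod big_mkcondr /=.
apply: eq_big => [U|U _]; rewrite pcomp_of_setK //.
case: ifPn => //; rewrite negb_forall => /existsP[j j_neq].
by rewrite (nu_eq0 j_neq) mulr0.
Qed.

Lemma cD_ribD_mod (L : seq (seq nat)) (i : 'F_p) :
  uniq L -> (forall a, (a \in L) = is_pcomp n a) ->
  cD n L i = #|[set S | ribD_mod S == i]|.
Proof.
move=> L_uniq L_mem; rewrite /cD -sum1_count (big_pcomp _ _ _ L_uniq L_mem) sum1dep_card.
by apply: eq_card => S; rewrite !inE ribD_modE.
Qed.

End Main.

Theorem theorem5p3 (p n k : nat) (nd : nat -> nat) :
  prime p -> odd p -> (4 <= n)%N ->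
  (forall j, (nd j < p)%N) -> (0 < nd k)%N ->
  n = (\sum_(j < k.+1) nd j * p ^ j)%N ->
  (#|Pset p k nd n| = if nd 0%N == 0%N then (\prod_(j < k.+1) (nd j).+1)%N
                      else ((\prod_(j < k.+1) (nd j).+1) - 1)%N) /\
  (forall L : seq (seq nat), uniq L -> (forall a, (a \in L) = is_pcomp n a) ->
   forall i : 'F_p,
     cD n L i =
     if (i == 0%R) || [forall j : 'I_k, nd j == p.-1] then
       (2 ^ (n - #|Pset p k nd n|) *
        #|[set T : {set 'I_n} | (T \subset Pset p k nd n) && (rDT p k nd L T == i)]|)%N
     else
       (2 ^ (n - #|Pset p k nd n| - 1) *
        #|[set T : {set 'I_n} | (T \subset Pset p k nd n) &&
            ((rDT p k nd L T == i) || (rDT p k nd L T == - i)%R)]|)%N).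
Proof.
move=> p_pr p_odd n_ge4 nd_lt nd_k nE; split; first exact: card_Pset.
move=> L L_uniq L_mem i.
rewrite (cD_ribD_mod p_pr p_odd n_ge4 nd_lt nE _ L_uniq L_mem).
have cardC : #|~: Pset p k nd n| = n - #|Pset p k nd n| by rewrite cardsCs setCK card_ord.
have r_split := ribD_mod_split p_pr nd_lt nE.
rewrite -(Pset_eqT p_pr p_odd n_ge4 nd_lt nd_k nE) -cardC.
case: ifPn => [i_or|].
  rewrite (card_fiber_full r_split i_or); congr (_ * _); apply: eq_card => T.
  by rewrite !inE (rDT_ribD_mod _ _ _ _ L_uniq L_mem).
rewrite negb_or => /andP[i0 PT].
(* Otherwise 2 * i = 0 in ['F_p], impossible for odd p and nonzero i. *)
have i_neq : (i != - i)%R.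
  by rewrite -addr_eq0 -mulr2n -mulr_natl mulf_neq0 // two_neq0.
rewrite (card_fiber_half r_split i_neq PT); congr (_ * _); apply: eq_card => T.
by rewrite !inE (rDT_ribD_mod _ _ _ _ L_uniq L_mem).
Qed.
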